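(* Let $\sqrt{1+z+z^2} = \sum_{k=0}^\infty b_k z^k$ be the Taylor expansion at $0$ of the branch of the square root that equals $1$ at $z=0$, and let $T_n(z)=\sum_{k=0}^n b_k z^k$. Let $f(z)=\sum_{k=0}^\infty a_k z^k$ be a holomorphic function on the open unit disk $\mathbb D$ with $\|f\|_\infty\le 1$, and write $S_{m,n}(z)=\sum_{k=m}^n a_k z^k$. Then for all integers $n\ge 2$ $$\|S_{n-2,n}\|_\infty \le \sum_{k=0}^n b_k^2 < \frac{1}{3} + \frac{2\sqrt{3}}{\pi}.$$ Moreover, for each $n\ge 2$, equality in the first inequality is attained by the function $f(z)=z^n T_n(1/z)/T_n(z)$.
   Context: For a holomorphic function $g\colon\mathbb D\to\mathbb C$ on the open unit disk $\mathbb D$, $\|g\|_\infty = \sup_{z\in\mathbb D}|g(z)|$. The coefficients $a_k$ are complex. The expression $z^nT_n(1/z)$ denotes the reciprocal polynomial $\sum_{k=0}^n b_k z^{n-k}$. *)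

(* Defs.v *)
From Stdlib Require Import Reals.
From Coquelicot Require Import Coquelicot.
Open Scope C_scope.

Definition holomorphic_on (r : R) (f : C -> C) : Prop :=
  forall z : C, (Cmod z < r)%R -> @ex_derive C_AbsRing C_NormedModule f z.

Definition power_series_on (r : R) (a : nat -> C) (f : C -> C) : Prop :=
  forall z : C, (Cmod z < r)%R ->
    @is_series C_AbsRing C_NormedModule (fun k => a k * z ^ k) (f z).

(* The supremum is an extended real, so that an unbounded function has norm
   p_infty. *)
Definition supnorm (g : C -> C) : Rbar :=
  Lub_Rbar (fun x : R => exists z : C, (Cmod z < 1)%R /\ x = Cmod (g z)).

Definition schur_function (f : C -> C) (a : nat -> C) : Prop :=
  holomorphic_on 1 f /\ power_series_on 1 a f /\ Rbar_le (supnorm f) 1%R.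

Definition coeff_section (a : nat -> C) (m n : nat) (z : C) : C :=
  sum_n_m (fun k => a k * z ^ k) m n.

Definition sqrt_branch (r : R) (g : C -> C) : Prop :=
  holomorphic_on r g /\
  (forall z : C, (Cmod z < r)%R -> g z ^ 2 = 1 + z + z ^ 2) /\
  g 0 = 1.

Definition taylor_poly (b : nat -> C) (n : nat) (z : C) : C :=
  sum_n (fun k => b k * z ^ k) n.

(* z^n * taylor_poly b n (1/z), as a polynomial in z. *)
Definition taylor_poly_reciprocal (b : nat -> C) (n : nat) (z : C) : C :=
  sum_n (fun k => b k * z ^ (n - k)) n.

Definition extremal (b : nat -> C) (n : nat) (z : C) : C :=
  taylor_poly_reciprocal b n z / taylor_poly b n z.

(* Main.v *)
(**
Write h = sqrt (1 + z + z^2) = sum b_k z^k and T for its section of order n. Since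
T^2 = 1 + z + z^2 + O(z^(n+1)), the sum a_(n-2) + a_(n-1) + a_n is the n-th coefficient
of f T^2, hence at most the mean of |T|^2 over the unit circle, which is sum b_k^2;
rotating f gives the same bound for S_(n-2,n). All means are averages over roots of
unity, so that no integration theory is needed.

The function T^*/T, with T^* the reciprocal polynomial, gives equality because
(T^*/T) T^2 = T^* T. What has to be shown is that T has no zero in the disk. Multiply by
Q = (1 - z)^(1/2): the product Q h is (1 - z^3)^(1/2), and summation by parts with the
log-convex coefficients of -Q shows that Q T = 1 - sum e_k z^k with e_k >= 0 and
sum e_k <= 1. The renewal sequence of (e_k) is bounded by 1, so 1/T has bounded
coefficients and converges in the disk.

Finally sum b_k^2 is the n-th coefficient of (T^*/T) (1 + z + z^2), hence at most the mean
of |1 + z + z^2| = |1 + 2 cos t|, which over the N-th roots of unity (3 | N) equals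
1/3 + 2 sqrt 3 cot (pi/N) / N; the inequality is strict as infinitely many b_k do not
vanish.
*)
Require Import Defs.
From Stdlib Require Import Reals Lra Lia.
From Coquelicot Require Import Coquelicot.
From HB Require structures.
From mathcomp Require all_boot all_order ssralg ssrnum poly ring lra zify.
From mathcomp Require boolp Rstruct.
Open Scope C_scope.

Module Analysis.
Local Open Scope R_scope.

(** * A finite cosine sum and the mean of |1 + 2 cos t| *)

Lemma x_cos_le_sin x : 0 < x <= PI / 2 -> x * cos x <= sin x.
Proof.
intros [x0 x1]; destruct (MVT_cor2 sin cos 0 x x0) as [c [Hc [c0 c1]]].
  intros; apply derivable_pt_lim_sin.
rewrite sin_0, !Rminus_0_r in Hc; rewrite Hc, Rmult_comm.
apply Rmult_le_compat_r; [lra|].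
apply cos_decr_1; lra.
Qed.

Lemma cos_ge_half x : 0 <= x <= 2 * (PI / 3) -> -1 / 2 <= cos x.
Proof.
intros H; rewrite <- cos_2PI3; generalize PI_RGT_0; intros P.
apply cos_decr_1; lra.
Qed.

Lemma cos_le_half x : 2 * (PI / 3) <= x <= 4 * (PI / 3) -> cos x <= -1 / 2.
Proof.
intros H; generalize PI_RGT_0; intros P.
destruct (Rle_dec x PI) as [Hx|Hx].
- rewrite <- cos_2PI3; apply cos_decr_1; lra.
- rewrite <- cos_2PI3.
  replace (cos x) with (cos (2 * PI - x)).
  + apply cos_decr_1; lra.
  + rewrite cos_minus, cos_2PI, sin_2PI; ring.
Qed.

Lemma sum_f_R0_rec (f S : nat -> R) n : S 0%nat = 0 ->
  (forall j, (j <= n)%nat -> S (j + 1)%nat = S j + f j) -> sum_f_R0 f n = S (n + 1)%nat.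
Proof.
intros S0; induction n as [|n IH]; intros H; rewrite H by lia.
- rewrite S0; simpl; ring.
- rewrite tech5, IH by (intros j Hj; apply H; lia).
  do 2 f_equal; lia.
Qed.

(* The mean of |1 + 2 cos t| over a period. *)
Definition tri_mean : R := 1 / 3 + 2 * sqrt 3 / PI.

(* The points where 1 + 2 cos changes sign are 2PI/3 and 4PI/3, the nodes M and 2M;
   between them the cosine sum telescopes. *)
Lemma sum_abs_1_2cos M : (0 < M)%nat ->
  sum_f_R0 (fun j => Rabs (1 + 2 * cos (INR j * (2 * PI / (3 * INR M))))) (3 * M - 1)
    <= 3 * INR M * tri_mean.
Proof.
intros HM; generalize PI_RGT_0; intros P.
assert (M1 : 1 <= INR M) by (apply (le_INR 1); lia).
set (t := PI / (3 * INR M)).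
assert (t0 : 0 < t) by (apply Rdiv_lt_0_compat; lra).
assert (tM : INR M * t = PI / 3) by (unfold t; field; lra).
assert (t1 : t <= PI / 3).
  rewrite <- tM; rewrite <- (Rmult_1_l t) at 1; apply Rmult_le_compat_r; lra.
assert (st : 0 < sin t) by (apply sin_gt_0; lra).
replace (2 * PI / (3 * INR M)) with (2 * t) by (unfold t; field; lra).
(* Since 2 cos (2 j t) sin t = sin ((2 j + 1) t) - sin ((2 j - 1) t), [psi] is a discrete
   antiderivative of 2 cos (2 j t). *)
set (psi j := sin ((2 * INR j - 1) * t) / sin t).
assert (tele : forall j, 2 * cos (INR j * (2 * t)) = psi (j + 1)%nat - psi j).
  intros j; unfold psi; rewrite plus_INR; simpl (INR 1).
  replace ((2 * (INR j + 1) - 1) * t) with (INR j * (2 * t) + t) by ring.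
  replace ((2 * INR j - 1) * t) with (INR j * (2 * t) - t) by ring.
  rewrite sin_plus, sin_minus; field; lra.
assert (jM : forall j, INR j * (2 * t) = 2 * (PI / 3) * (INR j / INR M)).
  intros j; unfold t; field; lra.
(* The partial sums of the absolute values: the sign is reversed between the nodes M and 2M, and the
   constants make neighbouring branches agree there. *)
set (S j := if (j <=? M)%nat then INR j + psi j - psi 0%nat
   else if (j <=? 2 * M)%nat then - INR j - psi j + 2 * INR M + 2 * psi M - psi 0%nat
   else INR j + psi j - 2 * INR M - 2 * psi (2 * M)%nat + 2 * psi M - psi 0%nat).
rewrite (sum_f_R0_rec _ S).
- replace (3 * M - 1 + 1)%nat with (3 * M)%nat by lia.
  unfold S; rewrite !(proj2 (Nat.leb_gt _ _)) by lia.
  assert (E0 : psi 0%nat = -1).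
    unfold psi; simpl (INR 0); replace ((2 * 0 - 1) * t) with (- t) by ring.
    rewrite sin_neg; field; lra.
  assert (E1 : psi M = sqrt 3 / 2 * (cos t / sin t) + 1 / 2).
    unfold psi; replace ((2 * INR M - 1) * t) with (2 * (INR M * t) - t) by ring.
    rewrite tM, sin_minus, cos_2PI3.
    rewrite sin_2PI3; field; lra.
  assert (E2 : psi (2 * M)%nat = - (sqrt 3 / 2 * (cos t / sin t)) + 1 / 2).
    unfold psi; rewrite mult_INR; simpl (INR 2).
    replace ((2 * ((1 + 1) * INR M) - 1) * t) with (PI + (PI / 3 - t)).
    2: lra.
    rewrite Rplus_comm, neg_sin, sin_minus, sin_PI3, cos_PI3; field; lra.
  assert (E3 : psi (3 * M)%nat = -1).
    unfold psi; rewrite mult_INR; simpl (INR 3).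
    replace ((2 * ((1 + 1 + 1) * INR M) - 1) * t) with (- t + 2 * INR 1 * PI).
    2: simpl; lra.
    rewrite sin_period, sin_neg; field; lra.
  rewrite E0, E1, E2, E3, mult_INR; simpl (INR 3).
  (* The sum equals M + 2 sqrt 3 cot t, and cot t <= 1 / t turns it into the bound. *)
  assert (C : cos t / sin t <= 3 * INR M / PI).
    replace (3 * INR M / PI) with (/ t) by (unfold t; field; lra).
    apply (Rmult_le_reg_r (t * sin t)); [apply Rmult_lt_0_compat; lra|].
    replace (cos t / sin t * (t * sin t)) with (t * cos t) by (field; lra).
    replace (/ t * (t * sin t)) with (sin t) by (field; lra).
    apply x_cos_le_sin; lra.
  assert (s3 : 0 <= sqrt 3) by apply sqrt_pos.
  unfold tri_mean.
  replace (3 * INR M * (1 / 3 + 2 * sqrt 3 / PI))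
    with (INR M + 2 * sqrt 3 * (3 * INR M / PI)) by (field; lra).
  assert (2 * sqrt 3 * (cos t / sin t) <= 2 * sqrt 3 * (3 * INR M / PI)).
    apply Rmult_le_compat_l; lra.
  lra.
- unfold S; simpl; ring.
- intros j Hj.
  assert (div : forall c d, (c * M <= j <= d * M)%nat ->
     2 * (PI / 3) * INR c <= INR j * (2 * t) <= 2 * (PI / 3) * INR d).
    intros c d [H1 H2]; rewrite jM; apply le_INR in H1; apply le_INR in H2.
    rewrite mult_INR in H1, H2; split; apply Rmult_le_compat_l; try lra;
    apply (Rmult_le_reg_r (INR M)); try lra;
    replace (INR j / INR M * INR M) with (INR j) by (field; lra); lra.
  assert (J : INR (j + 1) = INR j + 1) by (rewrite plus_INR; reflexivity).
  specialize (tele j).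
  destruct (Nat.le_gt_cases M j) as [H1|H1]; [destruct (Nat.le_gt_cases (2 * M) j) as [H2|H2]|].
  + rewrite Rabs_pos_eq.
    * unfold S; rewrite !(proj2 (Nat.leb_gt (j + 1) _)) by lia.
      destruct (Nat.eq_dec j (2 * M)) as [->|N].
      -- rewrite (proj2 (Nat.leb_gt _ _)), Nat.leb_refl by lia.
         rewrite tele, J, !mult_INR; simpl (INR 2); lra.
      -- rewrite !(proj2 (Nat.leb_gt _ _)) by lia; rewrite tele, J; lra.
    * destruct (div 2%nat 3%nat) as [D1 D2]; [lia|]; simpl in D1, D2.
      replace (INR j * (2 * t)) with (2 * PI - (2 * PI - INR j * (2 * t))) by ring.
      rewrite cos_minus, cos_2PI, sin_2PI.
      assert (-1 / 2 <= cos (2 * PI - INR j * (2 * t))) by (apply cos_ge_half; lra).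
      lra.
  + rewrite Rabs_left1.
    * unfold S; rewrite (proj2 (Nat.leb_gt (j + 1) _)), (proj2 (Nat.leb_le (j + 1) _)) by lia.
      destruct (Nat.eq_dec j M) as [->|N].
      -- rewrite Nat.leb_refl, J; lra.
      -- rewrite (proj2 (Nat.leb_gt _ _)), (proj2 (Nat.leb_le j _)) by lia; rewrite J; lra.
    * destruct (div 1%nat 2%nat) as [D1 D2]; [lia|]; simpl in D1, D2.
      assert (cos (INR j * (2 * t)) <= -1 / 2) by (apply cos_le_half; lra).
      lra.
  + rewrite Rabs_pos_eq.
    * unfold S; rewrite (proj2 (Nat.leb_le (j + 1) _)), (proj2 (Nat.leb_le j _)) by lia.
      rewrite J; lra.
    * destruct (div 0%nat 1%nat) as [D1 D2]; [lia|]; simpl in D1, D2.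
      assert (-1 / 2 <= cos (INR j * (2 * t))) by (apply cos_ge_half; lra).
      lra.
Qed.

(** * Power growth and uniform approximation of power series *)

Lemma le_of_pow_le (x M K : R) : 0 <= M -> (forall m, x ^ m <= M ^ m * K) -> x <= M.
Proof.
intros HM H; destruct (Rle_or_lt x M) as [|Hx]; [assumption|exfalso].
destruct (Req_dec M 0) as [->|HM0].
- specialize (H 1%nat); simpl in H; lra.
- destruct (Pow_x_infinity (x / M)) with (b := K + 1) as [m Hm].
  + assert (1 < x / M).
      apply (Rmult_lt_reg_r M); [lra|]; replace (x / M * M) with x by (field; lra); lra.
    rewrite Rabs_pos_eq; lra.
  + specialize (Hm m (Nat.le_refl m)); specialize (H m).
    assert (P : 0 < M ^ m) by (apply pow_lt; lra).
    rewrite Rabs_pos_eq in Hm.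
    * unfold Rdiv in Hm; rewrite Rpow_mult_distr, pow_inv in Hm.
      apply Rge_le, (Rmult_le_compat_r (M ^ m)) in Hm; [|lra].
      rewrite Rmult_assoc, Rinv_l in Hm by lra; lra.
    * apply pow_le, Rlt_le, Rdiv_lt_0_compat; lra.
Qed.

Lemma is_series_C_close (u : nat -> C) (l : C) (eps : R) (m : nat) :
  @is_series C_AbsRing C_NormedModule u l -> 0 < eps ->
  exists K, (m <= K)%nat /\ Cmod (l - sum_n u K) < eps.
Proof.
intros H He.
(* Balls of the normed module C are squares, so the modulus may exceed their radius by a factor up
   to sqrt 2. *)
assert (He' : 0 < eps / sqrt 2) by (apply Rdiv_lt_0_compat; [lra | apply Rlt_sqrt2_0]).
destruct (H _ (locally_ball l (mkposreal _ He'))) as [N HN].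
exists (max m N); split; [lia|].
assert (HB := HN (max m N) (Nat.le_max_r _ _)).
apply C_NormedModule_mixin_compat2 in HB; simpl in HB.
replace (sqrt 2 * (eps / sqrt 2)) with eps in HB by (field; apply sqrt2_neq_0).
rewrite <- Cmod_opp; replace (- (l - sum_n u (max m N)))%C with (minus (sum_n u (max m N)) l); auto.
unfold minus, opp, plus; simpl; ring.
Qed.

Lemma sum_n_m_geom (q : R) (n d : nat) : 0 <= q < 1 ->
  sum_n_m (fun k => q ^ k) n (n + d) <= q ^ n / (1 - q).
Proof.
intros Hq.
assert (E : sum_n_m (fun k => q ^ k) n (n + d) * (1 - q) = q ^ n - q ^ (n + d + 1)).
  induction d as [|d IH].
  - rewrite Nat.add_0_r, sum_n_n, pow_add; simpl; ring.
  - rewrite Nat.add_succ_r, sum_n_Sm by lia.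
    change plus with Rplus; rewrite Rmult_plus_distr_r, IH.
    replace (S (n + d) + 1)%nat with (n + d + 1 + 1)%nat by lia.
    replace (S (n + d)) with (n + d + 1)%nat by lia.
    rewrite (pow_add q (n + d + 1) 1); simpl; ring.
apply (Rmult_le_reg_r (1 - q)); [lra|]; rewrite E.
replace (q ^ n / (1 - q) * (1 - q)) with (q ^ n) by (field; lra).
assert (0 <= q ^ (n + d + 1)) by (apply pow_le; lra); lra.
Qed.

(** Convergence at a radius rho' between rho and r makes the terms there eventually less than 1, so
    for |z| <= rho they are dominated by powers of q = rho / rho', uniformly in z. *)
Lemma power_series_approx (r rho eps : R) (a : nat -> C) (f : C -> C) (m : nat) :
  power_series_on r a f -> 0 <= rho < r -> 0 < eps ->
  exists L, (m <= L)%nat /\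
    forall z, Cmod z <= rho -> Cmod (f z - sum_n (fun k => a k * z ^ k)%C L) <= eps.
Proof.
intros Hf Hrho Heps; set (rho' := (rho + r) / 2); set (q := rho / rho').
assert (H0 : 0 < rho') by (unfold rho'; lra).
assert (Hq : 0 <= q < 1).
  unfold q; split; [apply Rdiv_le_0_compat; lra|].
  apply (Rmult_lt_reg_r rho'); [lra|].
  replace (rho / rho' * rho') with rho by (field; lra); unfold rho'; lra.
assert (Hs : @ex_series C_AbsRing C_CompleteNormedModule (fun k => a k * RtoC rho' ^ k)%C).
  exists (f rho'); apply Hf; rewrite Cmod_R, Rabs_pos_eq; unfold rho'; lra.
destruct (Cauchy_ex_series _ Hs (mkposreal 1 Rlt_0_1)) as [N HN]; simpl in HN.
assert (term : forall k z, (N <= k)%nat -> Cmod z <= rho -> Cmod (a k * z ^ k) <= q ^ k).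
  intros k z Hk Hz; specialize (HN k k Hk Hk); rewrite sum_n_n in HN.
  change (Cmod (a k * RtoC rho' ^ k)%C < 1) in HN.
  rewrite Cmod_mult, Cmod_pow, Cmod_R, Rabs_pos_eq in HN by lra.
  rewrite Cmod_mult, Cmod_pow; unfold q.
  assert (P : 0 < rho' ^ k) by (apply pow_lt; lra).
  apply Rle_trans with (Cmod (a k) * rho ^ k).
    apply Rmult_le_compat_l; [apply Cmod_ge_0|].
    apply pow_incr; split; [apply Cmod_ge_0|exact Hz].
  replace (Cmod (a k) * rho ^ k) with (Cmod (a k) * rho' ^ k * (rho / rho') ^ k).
    rewrite <- (Rmult_1_l ((rho / rho') ^ k)) at 2; apply Rmult_le_compat_r; [|lra].
    apply pow_le; apply Hq.
  unfold Rdiv; rewrite Rpow_mult_distr, pow_inv; field; lra.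
destruct (pow_lt_1_zero q) with (y := eps * (1 - q)) as [N' HN'].
- rewrite Rabs_pos_eq; lra.
- apply Rmult_lt_0_compat; lra.
- exists (max m (max N N')); set (L := max m (max N N')); split; [lia|].
  intros z Hz; apply le_epsilon; intros e He.
  assert (Hz' : Cmod z < r) by lra.
  destruct (is_series_C_close _ _ _ (S L) (Hf z Hz') He) as [K [HK Hc]].
  set (u := fun k => (a k * z ^ k)%C) in *.
  replace (f z - sum_n u L)%C with (f z - sum_n u K + (sum_n u K - sum_n u L))%C by ring.
  eapply Rle_trans; [apply Cmod_triangle|].
  rewrite Rplus_comm; apply Rplus_le_compat; [|lra].
  replace (sum_n u K - sum_n u L)%C with (sum_n_m u (S L) K).
  + eapply Rle_trans; [apply (@norm_sum_n_m C_AbsRing C_NormedModule)|].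
    eapply Rle_trans.
    (* [sum_n_m_le] asks for a bound at every index: below [N] each term bounds itself, and the sum
       starts beyond [N]. *)
    * apply sum_n_m_le with (b := fun k => if (k <? N)%nat then Cmod (u k) else q ^ k).
      intros k; change (norm (u k)) with (Cmod (u k)).
      destruct (Nat.ltb_spec k N) as [Hk|Hk]; [lra|].
      apply term; auto.
    * rewrite (sum_n_m_ext_loc _ (fun k => q ^ k)).
      -- replace K with (S L + (K - S L))%nat by lia.
         eapply Rle_trans; [apply sum_n_m_geom; lra|].
         assert (HL : (S L >= N')%nat) by lia.
         specialize (HN' (S L) HL).
         rewrite Rabs_pos_eq in HN' by (apply pow_le; lra).
         apply (Rmult_le_reg_r (1 - q)); [lra|].
         replace (q ^ S L / (1 - q) * (1 - q)) with (q ^ S L) by (field; lra); lra.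
      -- intros k Hk; rewrite (proj2 (Nat.ltb_ge _ _)); [reflexivity | lia].
  + unfold sum_n; rewrite (sum_n_m_Chasles u 0 L K) by lia.
    assert (E : forall x y : C, y = (x + y - x)%C) by (intros; ring).
    apply E.
Qed.

Lemma ex_series_bounded_coeff (a : nat -> C) (M : R) (z : C) :
  (forall k, Cmod (a k) <= M) -> Cmod z < 1 ->
  @ex_series C_AbsRing C_NormedModule (fun k => a k * z ^ k)%C.
Proof.
intros Ha Hz.
apply (@ex_series_le C_AbsRing C_CompleteNormedModule) with (b := fun k => M * Cmod z ^ k).
- intros k; change (Cmod (a k * z ^ k)%C <= M * Cmod z ^ k).
  rewrite Cmod_mult, Cmod_pow; apply Rmult_le_compat_r; [apply pow_le, Cmod_ge_0 | apply Ha].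
- apply (@ex_series_scal R_AbsRing R_NormedModule), ex_series_geom.
  rewrite Rabs_pos_eq; [exact Hz | apply Cmod_ge_0].
Qed.

(** * Complex derivatives of quotients of polynomials *)

Lemma is_derive_Cinv (z : C) : z <> 0%C ->
  @is_derive C_AbsRing C_NormedModule Cinv z (- / (z * z))%C.
Proof.
intros Hz; assert (Pz := proj1 (Cmod_gt_0 z) Hz).
split; [apply (@is_linear_scal_l C_AbsRing C_NormedModule)|].
intros x Hx eps.
apply (@is_filter_lim_locally_unique C_AbsRing (AbsRing_NormedModule C_AbsRing)) in Hx.
subst x.
(* The first bound gives |y| > |z| / 2; the second then makes the remainder (y - z)^2 / (y z^2) at
   most eps |y - z|. *)
set (d := Rmin (Cmod z / 2) (eps * Cmod z * Cmod z * Cmod z / 2)).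
assert (Hd : 0 < d).
  destruct eps as [e He]; unfold d; simpl.
  apply Rmin_pos; [lra|].
  do 4 (try apply Rmult_lt_0_compat); lra.
exists (mkposreal d Hd); change (forall y : C, Cmod (y - z) < d ->
  Cmod (/ y - / z - (y - z) * - / (z * z))%C <= eps * Cmod (y - z)); intros y Hy.
assert (Hy1 := Rlt_le_trans _ _ _ Hy (Rmin_l _ _)).
assert (Hy2 := Rlt_le_trans _ _ _ Hy (Rmin_r _ _)).
assert (Py : Cmod z / 2 < Cmod y).
  assert (T := Cmod_triangle (z - y) y); replace (z - y + y)%C with z in T by ring.
  replace (z - y)%C with (- (y - z))%C in T by ring; rewrite Cmod_opp in T; lra.
assert (Hy0 : y <> 0%C) by (apply Cmod_gt_0; lra).
replace (/ y - / z - (y - z) * - / (z * z))%C with ((y - z) * ((y - z) * / (y * (z * z))))%C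
  by (field; auto).
rewrite Cmod_mult, Rmult_comm; apply Rmult_le_compat_r; [apply Cmod_ge_0|].
assert (Hyz : (y * (z * z))%C <> 0%C) by (repeat apply Cmult_neq_0; auto).
rewrite Cmod_mult, Cmod_inv, !Cmod_mult by auto.
assert (P : 0 < Cmod y * (Cmod z * Cmod z)) by (repeat apply Rmult_lt_0_compat; lra).
apply (Rmult_le_reg_r (Cmod y * (Cmod z * Cmod z))); [exact P|].
rewrite Rmult_assoc, Rinv_l, Rmult_1_r by lra.
apply Rle_trans with (eps * (Cmod z / 2 * (Cmod z * Cmod z))); [lra|].
destruct eps as [e He]; simpl.
apply Rmult_le_compat_l; [lra|]; apply Rmult_le_compat_r; [|lra].
apply Rlt_le, Rmult_lt_0_compat; lra.
Qed.

(* The two normed-module structures of C differ in their uniform structure only. *)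
Lemma is_derive_C_iff (f : C -> C) (z l : C) :
  @is_derive C_AbsRing (AbsRing_NormedModule C_AbsRing) f z l <->
  @is_derive C_AbsRing C_NormedModule f z l.
Proof.
split; intros [[H1 H2 H3] H4];
  (split; [split; [exact H1 | exact H2 | exact H3] | exact H4]).
Qed.

Lemma ex_derive_C_mult (f g : C -> C) (z : C) :
  @ex_derive C_AbsRing C_NormedModule f z -> @ex_derive C_AbsRing C_NormedModule g z ->
  @ex_derive C_AbsRing C_NormedModule (fun y => f y * g y)%C z.
Proof.
intros [df Hf] [dg Hg]; eexists; apply is_derive_C_iff.
apply (@is_derive_mult C_AbsRing f g z df dg); try (apply is_derive_C_iff; assumption).
intros; apply Cmult_comm.
Qed.

Lemma ex_derive_C_inv (f : C -> C) (z : C) : f z <> 0%C ->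
  @ex_derive C_AbsRing C_NormedModule f z ->
  @ex_derive C_AbsRing C_NormedModule (fun y => / f y)%C z.
Proof.
intros H0 [df Hf]; eexists.
apply (@is_derive_comp C_AbsRing C_NormedModule Cinv f z); [apply is_derive_Cinv, H0|].
apply is_derive_C_iff, Hf.
Qed.

Lemma ex_derive_C_monomial (c : C) (k : nat) (z : C) :
  @ex_derive C_AbsRing C_NormedModule (fun y => c * y ^ k)%C z.
Proof.
apply ex_derive_C_mult; [apply ex_derive_const|].
induction k as [|k IH]; simpl.
- apply ex_derive_const.
- apply ex_derive_C_mult; [eexists; apply is_derive_C_iff, is_derive_id | exact IH].
Qed.

Lemma ex_derive_C_sum_n (u : nat -> C -> C) (n : nat) (z : C) :
  (forall k, @ex_derive C_AbsRing C_NormedModule (u k) z) ->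
  @ex_derive C_AbsRing C_NormedModule (fun y => sum_n (fun k => u k y) n) z.
Proof.
intros H; induction n as [|n IH].
- apply ex_derive_ext with (f := u 0%nat); [|apply H].
  intros t; rewrite sum_O; reflexivity.
- apply ex_derive_ext with (f := fun y => plus (sum_n (fun k => u k y) n) (u (S n) y)).
  + intros t; rewrite sum_Sn; reflexivity.
  + apply (@ex_derive_plus C_AbsRing C_NormedModule); [exact IH | apply H].
Qed.

Lemma is_series_C_unique (u : nat -> C) (l l' : C) :
  @is_series C_AbsRing C_NormedModule u l -> @is_series C_AbsRing C_NormedModule u l' -> l = l'.
Proof.
intros H H'.
exact (@filterlim_locally_unique nat C_AbsRing C_NormedModule eventually _ (sum_n u) l l' H H').
Qed.

End Analysis.

Module Landau.
Import HB.structures all_boot all_order ssralg ssrnum poly ring lra zify.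
Import boolp Rstruct Analysis.
Set Implicit Arguments. Unset Strict Implicit. Unset Printing Implicit Defensive.
Import Order.TTheory GRing.Theory Num.Theory.
Local Open Scope ring_scope.

(** * Formal power series *)

Definition fps (R : Type) := nat -> R.

Section FpsRing.
Variable R : comNzRingType.
Implicit Types a b c : fps R.

HB.instance Definition _ := gen_eqMixin (fps R).
HB.instance Definition _ := gen_choiceMixin (fps R).

Definition fps_add a b : fps R := fun k => a k + b k.
Definition fps_opp a : fps R := fun k => - a k.
Definition fps_mul a b : fps R := fun k => \sum_(i < k.+1) a i * b (k - i)%N.

Fact fps_addA : associative fps_add.
Proof. by move=> a b c; apply/funext => k; rewrite /fps_add addrA. Qed.
Fact fps_addC : commutative fps_add.
Proof. by move=> a b; apply/funext => k; rewrite /fps_add addrC. Qed.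
Fact fps_add0 : left_id ((fun=> 0) : fps R) fps_add.
Proof. by move=> a; apply/funext => k; rewrite /fps_add add0r. Qed.
Fact fps_addN : left_inverse ((fun=> 0) : fps R) fps_opp fps_add.
Proof. by move=> a; apply/funext => k; rewrite /fps_add /fps_opp addNr. Qed.

HB.instance Definition _ :=
  GRing.isZmodule.Build (fps R) fps_addA fps_addC fps_add0 fps_addN.

Definition fps_trunc N a : {poly R} := \poly_(i < N) a i.

(** A coefficient of a product sees truncations only, so commutativity and associativity of the
    convolution are inherited from [{poly R}]. *)
Fact fps_mul_trunc a b N k : (k < N)%N ->
  fps_mul a b k = (fps_trunc N a * fps_trunc N b)`_k.
Proof.
move=> kN; rewrite coefM; apply: eq_bigr => i _; rewrite !coef_poly.
by rewrite !ifT //; [apply: leq_ltn_trans kN; rewrite leq_subr | apply: leq_trans kN].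
Qed.

Fact coef_mul_trunc (p q r : {poly R}) k N : (k < N)%N ->
  (forall i, (i < N)%N -> p`_i = q`_i) -> (p * r)`_k = (q * r)`_k.
Proof.
move=> kN pq; rewrite !coefM; apply: eq_bigr => i _; rewrite pq //.
by apply: leq_trans kN.
Qed.

Fact fps_mulC : commutative fps_mul.
Proof.
by move=> a b; apply/funext => k; rewrite !(fps_mul_trunc _ _ (ltnSn k)) mulrC.
Qed.

Fact fps_mulA : associative fps_mul.
Proof.
move=> a b c; apply/funext => k.
have E u v i : (i < k.+1)%N ->
    (fps_trunc k.+1 (fps_mul u v))`_i = (fps_trunc k.+1 u * fps_trunc k.+1 v)`_i.
  by move=> ik; rewrite {1}/fps_trunc coef_poly ik (fps_mul_trunc _ _ ik).
rewrite !(fps_mul_trunc _ _ (ltnSn k)) (coef_mul_trunc _ (ltnSn k) (E a b)).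
rewrite (mulrC (fps_trunc k.+1 a)) (coef_mul_trunc _ (ltnSn k) (E b c)).
by rewrite mulrC mulrA.
Qed.

Definition fps_one : fps R := fun k => (k == 0%N)%:R.

Fact fps_mul1 : left_id fps_one fps_mul.
Proof.
move=> a; apply/funext => k; rewrite /fps_mul big_ord_recl /= mul1r subn0.
by rewrite big1 ?addr0 // => i _; rewrite mul0r.
Qed.

Fact fps_mulDl : left_distributive fps_mul fps_add.
Proof.
move=> a b c; apply/funext => k; rewrite /fps_mul /fps_add -big_split /=.
by apply: eq_bigr => i _; rewrite mulrDl.
Qed.

Fact fps_one_neq0 : fps_one != 0.
Proof.
by apply/eqP => /(congr1 (fun a : fps R => a 0%N)) /eqP; rewrite (oner_eq0 R).
Qed.

HB.instance Definition _ := GRing.Zmodule_isComNzRing.Build (fps R)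
  fps_mulA fps_mulC fps_mul1 fps_mulDl fps_one_neq0.

Definition fpsX (d : nat) : fps R := fun k => (k == d)%:R.

Lemma fpsD a b k : (a + b) k = a k + b k. Proof. by []. Qed.
Lemma fpsB a b k : (a - b) k = a k - b k. Proof. by []. Qed.
Lemma fps1 k : (1 : fps R) k = (k == 0%N)%:R. Proof. by []. Qed.
Lemma fpsM a b k : (a * b) k = \sum_(i < k.+1) a i * b (k - i)%N.
Proof. by []. Qed.

Lemma fpsXM d a k : (fpsX d * a) k = if (k < d)%N then 0 else a (k - d)%N.
Proof.
rewrite fpsM; case: ltnP => kd.
  by rewrite big1 // => i _; rewrite /fpsX ltn_eqF ?mul0r //; have := ltn_ord i; lia.
have dk : (d < k.+1)%N by [].
rewrite (bigD1 (Ordinal dk)) //= /fpsX eqxx mul1r big1 ?addr0 // => i /eqP ne.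
by case: eqP => [e|]; rewrite ?mul0r //; case: ne; apply/val_inj.
Qed.

Lemma fpsM_eq a b c k : (forall i, (i <= k)%N -> a i = b i) -> (a * c) k = (b * c) k.
Proof. by move=> ab; rewrite !fpsM; apply: eq_bigr => i _; rewrite ab // -ltnS. Qed.

End FpsRing.

(** * The square root of 1 + z + z^2 and its truncations *)

Section SqrtSeries.
Variable F : realFieldType.
Implicit Types (a b c p : fps F).

(** The coefficients of theta(a^2) = 2 a theta(a) for the Euler operator theta = z d/dz. *)
Lemma fps_euler_sqr a k :
  k%:R * (a * a) k = 2 * \sum_(i < k.+1) i%:R * a i * a (k - i)%N.
Proof.
pose f i := i%:R * a i * a (k - i)%N.
have -> : k%:R * (a * a) k = \sum_(i < k.+1) (f i + f (k - i)%N).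
  rewrite fpsM mulr_sumr; apply: eq_bigr => i _; have ik : (i <= k)%N by rewrite -ltnS.
  rewrite /f subKn //; transitivity ((i%:R + (k - i)%:R) * (a i * a (k - i)%N)); last by ring.
  by rewrite -natrD subnKC.
rewrite big_split /= mulr_natl mulr2n; congr (_ + _).
by rewrite (reindex_inj rev_ord_inj) /=; apply: eq_bigr => i _; rewrite subSS subKn // -ltnS.
Qed.

(** The recurrence says (1 - z^d) z a' = - (d/2) z^d a, the equation of (1 - z^d)^(1/2). Then a^2
    obeys the recurrence of 1 - z^d, whose factor j - d vanishes at j = d and ends the series
    there. *)
Lemma fps_sqr_recurrence a d : (0 < d)%N -> a 0%N = 1 ->
    (forall i, (0 < i < d)%N -> a i = 0) ->
    (forall k, (k + d)%:R * a (k + d)%N = (k%:R - d%:R / 2) * a k) ->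
  a * a = 1 - fpsX F d.
Proof.
move=> d_gt0 a0 ad arec; apply/funext => k; rewrite fpsB fps1 /fpsX.
have low i : (0 < i < d)%N -> (a * a) i = 0.
  move=> /andP[i_gt0 id].
  suff: i%:R * (a * a) i = 0 by move/eqP; rewrite mulf_eq0 pnatr_eq0 gtn_eqF // => /eqP.
  rewrite fps_euler_sqr big1 ?mulr0 // => -[[|j] /= ji] _; first by rewrite !mul0r.
  by rewrite ad ?mulr0 ?mul0r //; lia.
have rec j : (j + d)%:R * (a * a) (j + d)%N = (j%:R - d%:R) * (a * a) j.
  rewrite fps_euler_sqr -(big_mkord xpredT (fun i => i%:R * a i * a (j + d - i)%N)).
  rewrite (big_cat_nat _ (n := d)) //=; last by lia.
  rewrite big_nat_cond big1 ?add0r; last first.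
    move=> [_|i /andP[/andP[_ id] _]]; first by rewrite !mul0r.
    by rewrite ad ?mulr0 ?mul0r.
  rewrite -{1}[d]add0n big_addn -addSn addnK big_mkord.
  rewrite mulrBl fps_euler_sqr fpsM.
  have -> : d%:R * \sum_(i < j.+1) a i * a (j - i)%N
      = 2 * \sum_(i < j.+1) d%:R / 2 * a i * a (j - i)%N.
    by rewrite !mulr_sumr; apply: eq_bigr => i _; field.
  rewrite -mulrBr -sumrB; congr (_ * _); apply: eq_bigr => i _.
  by rewrite arec subnDr; ring.
elim/ltn_ind: k => k IH.
have [->|k0] := eqVneq k 0%N.
  by rewrite fpsM big_ord_recl big_ord0 /= a0 mulr1 addr0 eq_sym gtn_eqF // subr0.
have [kd|dk] := ltnP k d.
  by rewrite low ?lt0n ?k0 // ltn_eqF // subrr.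
have k_neq0 : k%:R != 0 :> F by rewrite pnatr_eq0.
apply: (mulfI k_neq0); rewrite -{1 2}(subnK dk) rec.
have [->|kd] := eqVneq k d.
    by rewrite subnn IH ?lt0n ?k0 //= (ltn_eqF d_gt0) /=; ring.
rewrite IH; last by lia.
rewrite subn_eq0 leqNgt [(d < k)%N]ltn_neqAle eq_sym kd dk /= !sub0r oppr0 mulr0.
have [e|_] := eqVneq (k - d)%N d; last by rewrite oppr0 mulr0.
by rewrite e subrr mul0r.
Qed.

Lemma fpsX_exp d : fpsX F d = fpsX F 1 ^+ d.
Proof.
elim: d => [|d IH]; apply/funext => k; first by rewrite expr0 fps1.
by rewrite exprS -IH fpsXM /fpsX; case: k => [|k] //=; rewrite subn1.
Qed.

(** The series of 1 / (1 - z): multiplication by it takes partial sums of coefficients. *)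
Definition geom : fps F := fun=> 1.

Lemma geom_inv : (1 - fpsX F 1) * geom = 1.
Proof.
apply/funext => k; rewrite mulrBl mul1r fpsB fpsXM fps1 /geom.
by case: k => [|k]; rewrite ?subr0 ?subrr.
Qed.

(** The central binomial coefficients over 4^k, which are the coefficients of (1 - z)^(-1/2). *)
Fixpoint invsqrt_coef (k : nat) : F :=
  if k is j.+1 then invsqrt_coef j * ((2 * j%:R + 1) / (2 * j%:R + 2)) else 1.

Definition invsqrt : fps F := invsqrt_coef.
Global Arguments invsqrt : simpl never.

(** The series of (1 - z)^(1/2), obtained by integrating - (1 - z)^(-1/2) / 2. *)
Definition sqrt1B : fps F :=
  fun k => if k is j.+1 then - invsqrt j / (2 * j%:R + 2) else 1.
Global Arguments sqrt1B : simpl never.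

Definition sqrt1B3 : fps F := fun k => if (3 %| k)%N then sqrt1B (k %/ 3) else 0.

(** From 1 + z + z^2 = (1 - z^3) / (1 - z); [sqrt1B3] is (1 - z^3)^(1/2). *)
Definition sqrt_tri : fps F := sqrt1B3 * invsqrt.

Lemma double_natrS_neq0 j : 2 * j%:R + 2 != 0 :> F.
Proof. by rewrite -natrM -natrD pnatr_eq0 addn2. Qed.

Lemma invsqrtS j : invsqrt j.+1 = invsqrt j * ((2 * j%:R + 1) / (2 * j%:R + 2)).
Proof. by []. Qed.

Lemma invsqrt_gt0 k : 0 < invsqrt k.
Proof.
elim: k => [|k IH]; first exact: ltr01.
by rewrite invsqrtS mulr_gt0 // divr_gt0 // ltr_wpDl // mulr_ge0 // ler0n.
Qed.

Lemma sqrt1BS_lt0 k : sqrt1B k.+1 < 0.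
Proof.
by rewrite /sqrt1B mulNr oppr_lt0 divr_gt0 ?invsqrt_gt0 // ltr_wpDl // mulr_ge0 ?ler0n.
Qed.

Lemma sqrt1B_recurrence k :
  (k.+1)%:R * sqrt1B k.+1 = (k%:R - 1 / 2) * sqrt1B k.
Proof.
case: k => [|k]; first by rewrite /sqrt1B /invsqrt /=; field.
rewrite /sqrt1B invsqrtS -!natr1; field.
by have := ler0n F k => ?; rewrite !lt0r_neq0 //; lra.
Qed.

Lemma sqrt1B_sqr : sqrt1B * sqrt1B = 1 - fpsX F 1.
Proof.
apply: fps_sqr_recurrence => // [[|[|i]]|k] //.
by rewrite addn1 sqrt1B_recurrence.
Qed.

Lemma sqrt1B3_sqr : sqrt1B3 * sqrt1B3 = 1 - fpsX F 3.
Proof.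
apply: fps_sqr_recurrence => // [[|[|[|i]]]|k] //.
rewrite /sqrt1B3 dvdn_addl // divnDr // divnn /= addn1.
case: dvdnP => [[j ->]|_]; last by rewrite !mulr0.
have := sqrt1B_recurrence j; rewrite mulnK // natrD natrM -natr1 => e.
have -> : j%:R * 3%:R + 3%:R = 3%:R * (j%:R + 1) :> F by ring.
by rewrite -mulrA e; field.
Qed.

(** In coefficients: the partial sums of [sqrt1B] are the coefficients of [invsqrt]. *)
Lemma invsqrtE : invsqrt = geom * sqrt1B.
Proof.
suff e : (1 - fpsX F 1) * invsqrt = sqrt1B.
  by rewrite -e mulrA [geom * _]mulrC geom_inv mul1r.
apply/funext => -[|k]; rewrite mulrBl mul1r fpsB fpsXM; first by rewrite subr0.
rewrite ltnS ltn0 subSS subn0 invsqrtS; have := double_natrS_neq0 k => h.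
by rewrite /sqrt1B; field.
Qed.

Lemma invsqrt_sqrt1B : invsqrt * sqrt1B = 1.
Proof. by rewrite invsqrtE -mulrA sqrt1B_sqr mulrC geom_inv. Qed.

Lemma sqrt_tri_sqr : sqrt_tri * sqrt_tri = 1 + fpsX F 1 + fpsX F 2.
Proof.
rewrite (fpsX_exp 2) /sqrt_tri mulrACA sqrt1B3_sqr {2}invsqrtE.
rewrite [invsqrt * _]mulrCA invsqrt_sqrt1B mulr1 (fpsX_exp 3).
transitivity ((1 + fpsX F 1 + fpsX F 1 ^+ 2) * ((1 - fpsX F 1) * geom)); first by ring.
by rewrite geom_inv mulr1.
Qed.

Lemma sqrt_triM_sqrt1B : sqrt_tri * sqrt1B = sqrt1B3.
Proof. by rewrite -mulrA invsqrt_sqrt1B mulr1. Qed.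

(** The product is (1 - z^3)^(1/2) / (1 - z), whose coefficients are partial sums of [sqrt1B3];
    these are constant on blocks of three indices. *)
Lemma sqrt_triM_invsqrt k : (sqrt_tri * invsqrt) k = invsqrt (k %/ 3).
Proof.
rewrite {1}invsqrtE [geom * _]mulrC mulrA sqrt_triM_sqrt1B mulrC.
have -> : forall k, (geom * sqrt1B3) k = \sum_(i < k.+1) sqrt1B3 i.
  by move=> j; rewrite mulrC fpsM; apply: eq_bigr => i _; rewrite mulr1.
elim: k => [|k IH]; first by rewrite big_ord_recl big_ord0 addr0.
rewrite big_ord_recr IH /= /sqrt1B3 divnS //.
case: (3 %| k.+1)%N; rewrite ?add1n ?add0n ?addr0 // invsqrtS.
by have := double_natrS_neq0 (k %/ 3) => h; rewrite /sqrt1B; field.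
Qed.

End SqrtSeries.

(** * Positivity and log-convexity of the coefficients *)

Section SqrtPositivity.
Variable F : realFieldType.
Implicit Types (a b c p : fps F).

Lemma sum_sqrt1B3 m (f : nat -> F) :
  \sum_(i < 3 * m + 2) sqrt1B3 F i * f i = \sum_(j < m.+1) sqrt1B F j * f (3 * j)%N.
Proof.
have e3 j : (3 %| 3 * j)%N = true by rewrite dvdn_mulr.
elim: m => [|m IH]; first by rewrite !big_ord_recl !big_ord0 /sqrt1B3 /= mul0r !addr0.
have -> : (3 * m.+1 + 2 = (3 * m + 2).+3)%N by lia.
rewrite 3!big_ord_recr IH [RHS]big_ord_recr /= /sqrt1B3.
have -> : (3 * m + 2).+1 = (3 * m.+1)%N by lia.
rewrite e3 mulKn // -[(3 * m.+1).+1]addn1 !(dvdn_addr _ (dvdn_mulr _ (dvdnn 3))) /=.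
by rewrite !mul0r !addr0.
Qed.

Definition third_ratio (m : nat) : F := invsqrt F (3 * m + 1)%N / invsqrt F m.

(** Consecutive ratios have the quotient (6 m + 5) (6 m + 7) / ((6 m + 4) (6 m + 8)), which exceeds
    1. *)
Lemma third_ratio_ltS m : third_ratio m < third_ratio m.+1.
Proof.
rewrite /third_ratio; have -> : (3 * m.+1 + 1 = (3 * m + 1).+3)%N by lia.
have x0 := invsqrt_gt0 F (3 * m + 1)%N; have g0 := invsqrt_gt0 F m.
have m0 := ler0n F m; rewrite !invsqrtS -!natr1 natrD natrM.
rewrite -subr_gt0; set x := invsqrt F _ in x0 *; set g := invsqrt F m in g0 *.
set t : F := m%:R in m0 *.
rewrite [ltRHS](_ : _ = x / g * (3 / ((6 * t + 4) * (6 * t + 8)))); last first.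
  by field; rewrite !lt0r_neq0 //; lra.
by rewrite mulr_gt0 ?divr_gt0 ?mulr_gt0 //; lra.
Qed.

(* The ratio of invsqrt (3 m + 1) to invsqrt m increases, so the vanishing of the
   m-th coefficient of sqrt1B * invsqrt = 1 becomes a strict inequality. *)
Lemma sqrt_tri_mod1_gt0 m : 0 < sqrt_tri F (3 * m + 1)%N.
Proof.
have -> : sqrt_tri F (3 * m + 1)%N
    = \sum_(j < m.+1) sqrt1B F j * invsqrt F (3 * (m - j) + 1)%N.
  rewrite /sqrt_tri fpsM -[(3 * m + 1).+1]addn1 -addnA addn1.
  rewrite (sum_sqrt1B3 m (fun i => invsqrt F (3 * m + 1 - i)%N)).
  by apply: eq_bigr => j _; congr (_ * invsqrt F _); have := ltn_ord j; lia.
case: m => [|m].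
  by rewrite big_ord_recl big_ord0 mul1r addr0 invsqrt_gt0.
have gm := invsqrt_gt0 F m.+1.
have E : \sum_(j < m.+2) sqrt1B F j * invsqrt F (m.+1 - j)%N = 0.
  by rewrite -fpsM mulrC invsqrt_sqrt1B.
(* Subtracting [third_ratio m.+1] times the vanishing sum removes the term j = 0; for j > 0 both the
   coefficient of [sqrt1B] and the difference of ratios are negative. *)
have -> : \sum_(j < m.+2) sqrt1B F j * invsqrt F (3 * (m.+1 - j) + 1)%N
  = \sum_(j < m.+2) sqrt1B F j * invsqrt F (m.+1 - j)%N
      * (third_ratio (m.+1 - j)%N - third_ratio m.+1).
  under [RHS]eq_bigr do rewrite mulrBr.
  rewrite sumrB -mulr_suml E mul0r subr0; apply: eq_bigr => j _.
  by rewrite -mulrA [invsqrt F _ * _]mulrC mulfVK ?gt_eqF ?invsqrt_gt0.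
have mono : {homo third_ratio : i j / (i < j)%N >-> i < j}.
  exact: (homo_ltn lt_trans third_ratio_ltS).
rewrite !big_ord_recl /= subn0 subrr mulr0 add0r ltr_wpDr //.
  apply: sumr_ge0 => j _; rewrite -mulrA mulr_le0 ?(ltW (sqrt1BS_lt0 F _)) //.
  rewrite pmulr_rle0 ?invsqrt_gt0 // subr_le0 ltW // mono //.
  by rewrite /bump /=; lia.
rewrite -mulrA nmulr_rgt0 ?sqrt1BS_lt0 // pmulr_rlt0 ?invsqrt_gt0 //.
by rewrite subr_lt0 mono // subn1.
Qed.

(* Summation by parts: passing from k to k + 1 multiplies the weights by ratios
   that decrease with j, and the partial sums up to k are nonnegative. *)
Lemma log_convex_sum_ge0 p b :
    (forall k, 0 < p k) -> (forall k, p k.+1 * p k.+1 <= p k * p k.+2) ->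
    let E n k := \sum_(j < n.+1) b j * p (k - j)%N in
    0 <= b 0%N ->
    (forall k, 0 <= E k k -> 0 <= E k k.+1 -> 0 <= E k.+1 k.+1) ->
  forall k n, (n <= k)%N -> 0 <= E n k.
Proof.
move=> p0 pconv E b0 diag.
have ES n k : E n.+1 k = E n k + b n.+1 * p (k - n.+1)%N by rewrite /E big_ord_recr.
have E0 k : E 0%N k = b 0%N * p k by rewrite /E big_ord_recl big_ord0 addr0 subn0.
elim=> [|k IH] n; first by rewrite leqn0 => /eqP ->; rewrite E0 mulr_ge0 // ltW.
(* The ratio p (k.+1 - m) / p (k - m) of the last weight is the smallest, so [E m] grows at least by
   this factor. *)
have step m : (m <= k)%N -> E m k * p (k.+1 - m)%N <= E m k.+1 * p (k - m)%N.
  elim: m => [|m IHm] mk; first by rewrite !E0 !subn0 -!mulrA [p k * _]mulrC.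
  have := IHm (ltnW mk); rewrite !ES !subSS.
  have -> : (k.+1 - m = (k - m.+1).+2)%N by lia.
  have -> : (k - m = (k - m.+1).+1)%N by lia.
  set l := (k - m.+1)%N => h; rewrite !mulrDl; apply: lerD; last first.
    by rewrite -!mulrA [p l * _]mulrC.
  rewrite -(ler_pM2r (p0 l.+1)) -mulrA.
  apply: (le_trans (ler_wpM2l (IH _ (ltnW mk)) (pconv l))).
  by rewrite [p l * _]mulrC mulrA [leRHS]mulrAC ler_pM2r.
have le_k m : (m <= k)%N -> 0 <= E m k.+1.
  move=> mk; rewrite -(pmulr_lge0 _ (p0 (k - m)%N)); apply: le_trans (step m mk).
  by rewrite mulr_ge0 ?IH // ltW.
rewrite leq_eqVlt => /predU1P[->|]; last exact: le_k.
by apply: diag; [apply: IH | apply: le_k].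
Qed.

Lemma invsqrt_log_convex k :
  invsqrt F k.+1 * invsqrt F k.+1 <= invsqrt F k * invsqrt F k.+2.
Proof.
rewrite !invsqrtS -natr1; have g := invsqrt_gt0 F k; have k0 := ler0n F k.
rewrite -subr_ge0; set x := invsqrt F k in g *; set t : F := k%:R in k0 *.
rewrite [leRHS](_ : _ = x * x * ((2 * t + 1) / (2 * t + 2))
    * (2 / ((2 * t + 2) * (2 * t + 4)))); last first.
  by field; rewrite !lt0r_neq0 //; lra.
have x0 : 0 <= x := ltW g; apply: mulr_ge0; last by rewrite divr_ge0 ?mulr_ge0; lra.
by apply: mulr_ge0; [apply: mulr_ge0 | rewrite divr_ge0; lra].
Qed.

Lemma sqrt1B_log_convex k :
  sqrt1B F k.+2 * sqrt1B F k.+2 <= sqrt1B F k.+1 * sqrt1B F k.+3.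
Proof.
rewrite /sqrt1B !invsqrtS -!natr1; have g := invsqrt_gt0 F k; have k0 := ler0n F k.
rewrite -subr_ge0; set x := invsqrt F k in g *; set t : F := k%:R in k0 *.
rewrite [leRHS](_ : _ = x * x / (2 * t + 2) / (2 * t + 2) * ((2 * t + 1) / (2 * t + 4))
    * (6 / ((2 * t + 4) * (2 * t + 6)))); last first.
  by field; rewrite !lt0r_neq0 //; lra.
have x0 : 0 <= x := ltW g; have t2 : 0 <= (2 * t + 2)^-1 by rewrite invr_ge0; lra.
apply: mulr_ge0; last by rewrite divr_ge0 ?mulr_ge0; lra.
apply: mulr_ge0; last by rewrite divr_ge0; lra.
by do 3?apply: mulr_ge0.
Qed.

End SqrtPositivity.

(** * The inverse of the truncation has bounded coefficients *)

Section Truncation.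
Variable F : realFieldType.
Implicit Types (a b c p : fps F).

Definition fps_cut n a : fps F := fun k => if (k <= n)%N then a k else 0.

Lemma fps_cutM_low n a b k : (k <= n)%N -> (fps_cut n a * b) k = (a * b) k.
Proof. by move=> kn; apply: fpsM_eq => i ik; rewrite /fps_cut (leq_trans ik). Qed.

Lemma fps_cutM_high n a b k : (n <= k)%N ->
  (fps_cut n a * b) k = \sum_(j < n.+1) a j * b (k - j)%N.
Proof.
move=> nk; rewrite fpsM -(big_mkord xpredT (fun i => fps_cut n a i * b (k - i)%N)).
rewrite (big_cat_nat _ (n := n.+1)) //= addrC big_nat_cond big1 ?add0r; last first.
  by move=> i /andP[/andP[ni _] _]; rewrite /fps_cut leqNgt ni mul0r.
by rewrite big_mkord; apply: eq_bigr => i _; rewrite /fps_cut -ltnS ltn_ord.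
Qed.

Lemma sqrt_tri0 : sqrt_tri F 0%N = 1.
Proof. by rewrite /sqrt_tri fpsM big_ord_recl big_ord0 addr0 mulr1. Qed.

Lemma sqrt1B3_le0 k : (0 < k)%N -> sqrt1B3 F k <= 0.
Proof.
rewrite /sqrt1B3; case: dvdnP => // -[[|j] -> //]; rewrite mulnK // => _.
exact/ltW/sqrt1BS_lt0.
Qed.

Lemma sqrt1B3_eq0 k : ~~ (3 %| k)%N -> sqrt1B3 F k = 0.
Proof. by rewrite /sqrt1B3 => /negbTE ->. Qed.

Lemma sum_sqrt_triM_sqrt1B k :
  \sum_(j < k.+1) sqrt_tri F j * - sqrt1B F (k.+1 - j)%N = sqrt_tri F k.+1 - sqrt1B3 F k.+1.
Proof.
rewrite -sqrt_triM_sqrt1B fpsM [in RHS]big_ord_recr /= subnn mulr1.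
by under eq_bigr do rewrite mulrN; rewrite sumrN; ring.
Qed.

(** Up to [n] the product agrees with [sqrt1B3]. Beyond [n] it is minus a sum with the log-convex
    weights [- sqrt1B F i.+1], and [log_convex_sum_ge0] applies once its diagonal condition is
    verified. *)
Lemma cut_sqrt1B_le0 n k : (0 < k)%N -> (fps_cut n (sqrt_tri F) * sqrt1B F) k <= 0.
Proof.
have [kn k0|nk _] := leqP k n.
  by rewrite fps_cutM_low // sqrt_triM_sqrt1B sqrt1B3_le0.
rewrite fps_cutM_high; last exact: ltnW.
rewrite -oppr_ge0 -sumrN; case: k nk => // k nk.
under eq_bigr => j _ do rewrite -mulrN (subSn (leq_trans (ltnSE (ltn_ord j)) nk)).
apply: (@log_convex_sum_ge0 F (fun i => - sqrt1B F i.+1) (sqrt_tri F) _ _ _ _ k n nk)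
  => [i|i||i].
- by rewrite oppr_gt0 sqrt1BS_lt0.
- by rewrite !mulrNN sqrt1B_log_convex.
- by rewrite sqrt_tri0.
have E m : \sum_(j < m.+1) sqrt_tri F j * - sqrt1B F (m - j).+1
    = sqrt_tri F m.+1 - sqrt1B3 F m.+1.
  rewrite -sum_sqrt_triM_sqrt1B; apply: eq_bigr => j _.
  by rewrite subSn // -ltnS.
rewrite !E => h0 h1.
(* The new diagonal sum is [sqrt_tri] - [sqrt1B3] at i + 2. If i + 2 is 1 mod 3, it is positive by
   [sqrt_tri_mod1_gt0]. Otherwise 3 does not divide i + 1, so the previous diagonal sum is b_(i+1)
   itself and the new last term is nonnegative. *)
have [e|ne] := eqVneq (i.+2 %% 3)%N 1%N.
  rewrite (@sqrt1B3_eq0 i.+2) ?subr0; last by rewrite /dvdn e.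
  have -> : (i.+2 = 3 * (i.+2 %/ 3) + 1)%N by rewrite {1}(divn_eq i.+2 3) e mulnC.
  exact/ltW/sqrt_tri_mod1_gt0.
rewrite -E big_ord_recr /= subnn addr_ge0 // mulr_ge0 //; last first.
  by rewrite oppr_ge0 ltW // sqrt1BS_lt0.
move: h0; rewrite sqrt1B3_eq0 ?subr0 //.
by rewrite /dvdn; apply: contra ne => /eqP e; apply/eqP; lia.
Qed.

(** The partial sums are the coefficients of T (1 - z)^(-1/2). The weights [invsqrt] are log-convex,
    and the diagonal sums are the positive numbers [invsqrt F (k %/ 3)]. *)
Lemma cut_sqrt1B_partial_ge0 n k :
  0 <= \sum_(i < k.+1) (fps_cut n (sqrt_tri F) * sqrt1B F) i.
Proof.
have -> : \sum_(i < k.+1) (fps_cut n (sqrt_tri F) * sqrt1B F) i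
    = (fps_cut n (sqrt_tri F) * invsqrt F) k.
  rewrite invsqrtE [geom F * _]mulrC mulrA fpsM.
  by apply: eq_bigr => i _; rewrite mulr1.
have [kn|nk] := leqP k n.
  by rewrite fps_cutM_low // sqrt_triM_invsqrt ltW ?invsqrt_gt0.
rewrite fps_cutM_high; last exact: ltnW.
apply: (@log_convex_sum_ge0 F (invsqrt F) (sqrt_tri F) _ _ _ _ k n (ltnW nk)).
- exact: invsqrt_gt0.
- exact: invsqrt_log_convex.
- by rewrite sqrt_tri0.
by move=> i _ _; rewrite -fpsM sqrt_triM_invsqrt ltW ?invsqrt_gt0.
Qed.

Lemma fps_exp_low a m k : a 0%N = 0 -> (k < m)%N -> (a ^+ m) k = 0.
Proof.
move=> a0; elim: m k => // m IH k km; rewrite exprS fpsM big1 // => -[[|i] ik] _ /=.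
  by rewrite a0 mul0r.
by rewrite IH ?mulr0 //; lia.
Qed.

(** Neumann series: e = 1 - c has no constant term, so e^m starts at order m and the k-th
    coefficient is final after k + 1 terms. *)
Lemma fps_inverse c : c 0%N = 1 -> exists v : fps F, c * v = 1.
Proof.
move=> c0; pose e : fps F := 1 - c; have e0 : e 0%N = 0 by rewrite /e fpsB fps1 c0 subrr.
pose V N : fps F := \sum_(m < N) e ^+ m.
have VD N : V N.+1 = V N + e ^+ N by exact: big_ord_recr.
have VS k j : (V (k.+1 + j)%N) k = (V k.+1) k.
  elim: j => [|j IH]; first by rewrite addn0.
  by rewrite addnS VD fpsD IH fps_exp_low ?addr0 //; lia.
exists (fun k => V k.+1 k); apply/funext => k; rewrite mulrC.
rewrite (@fpsM_eq _ _ (V k.+1)); last first.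
  by move=> i ik; rewrite -(VS i (k - i)%N); congr (V _ _); lia.
have -> : V k.+1 * c = 1 - e ^+ k.+1.
  have -> : c = 1 - e by rewrite /e; ring.
  by rewrite -{2}(expr1n _ k.+1) subrXX mulrC; congr (_ * _);
    apply: eq_bigr => i _; rewrite expr1n mul1r.
by rewrite fpsB fps_exp_low // subr0.
Qed.

(* With c = 1 - e this is the renewal equation v_k = sum e_i v_(k-i). *)
Lemma renewal_bounds c v : c 0%N = 1 -> (forall k, (0 < k)%N -> c k <= 0) ->
    (forall k, 0 <= \sum_(i < k.+1) c i) -> c * v = 1 ->
  forall k, 0 <= v k <= 1.
Proof.
move=> c0 c_le0 csum cv; elim/ltn_ind=> -[_|k IH].
  have := congr1 (fun a : fps F => a 0%N) cv.
  by rewrite fpsM big_ord_recl big_ord0 addr0 c0 mul1r => ->; rewrite fps1 ler01 lexx.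
have : (c * v) k.+1 = 0 by rewrite cv.
rewrite fpsM big_ord_recl c0 mul1r subn0 => /eqP; rewrite addr_eq0 -sumrN => /eqP ->.
have IHi (i : 'I_k.+1) : 0 <= v (k.+1 - lift ord0 i)%N <= 1.
  by apply: IH; rewrite /= /bump /=; lia.
have ci (i : 'I_k.+1) : 0 <= - c (lift ord0 i) by rewrite oppr_ge0 c_le0.
apply/andP; split.
  by apply: sumr_ge0 => i _; rewrite -mulNr mulr_ge0 //; case/andP: (IHi i).
apply: (@le_trans _ _ (\sum_(i < k.+1) - c (lift ord0 i))).
  apply: ler_sum => i _; rewrite -mulNr -[leRHS]mulr1 ler_wpM2l //.
  by case/andP: (IHi i).
by have := csum k.+1; rewrite big_ord_recl c0 sumrN; lra.
Qed.

(** With Q = [sqrt1B] and v the inverse of T Q, the inverse of T is Q v. As 0 <= v_k <= 1, its k-th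
    coefficient is at most the sum of |Q_i| for i <= k, which is 2 - [invsqrt F k] because Q_0 = 1
    is the only positive coefficient of Q. *)
Lemma cut_sqrt_tri_inverse n :
  exists2 w : fps F, fps_cut n (sqrt_tri F) * w = 1 & forall k, `|w k| <= 2.
Proof.
set T := fps_cut n (sqrt_tri F); pose c := T * sqrt1B F.
have c0 : c 0%N = 1.
  by rewrite /c fpsM big_ord_recl big_ord0 addr0 mulr1 /T /fps_cut sqrt_tri0.
have [v cv] := fps_inverse c0.
have vk := renewal_bounds c0 (@cut_sqrt1B_le0 n) (cut_sqrt1B_partial_ge0 n) cv.
exists (sqrt1B F * v) => [|k]; first by rewrite mulrA.
rewrite fpsM; apply: le_trans (ler_norm_sum _ _ _) _.
apply: (@le_trans _ _ (\sum_(i < k.+1) `|sqrt1B F i|)).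
  apply: ler_sum => i _; rewrite normrM -[leRHS]mulr1 ler_wpM2l //.
  by have /andP[v0 v1] := vk (k - i)%N; rewrite ger0_norm.
have : \sum_(i < k.+1) sqrt1B F i = invsqrt F k.
  by rewrite invsqrtE mulrC fpsM; apply: eq_bigr => i _; rewrite mulr1.
rewrite !big_ord_recl normr1 => e; have := invsqrt_gt0 F k.
under eq_bigr => i _ do rewrite ltr0_norm ?sqrt1BS_lt0 //.
by rewrite sumrN -e; set s := \sum_(i < k) _; have -> : sqrt1B F ord0 = 1 by []; lra.
Qed.

End Truncation.

(** * Polynomials on the unit circle *)

(* Coquelicot reads the arguments of these constants in R_scope and C_scope. *)
#[local] Bind Scope ring_scope with R C.
#[local] Arguments Cmod _%_ring_scope.
#[local] Arguments RtoC _%_ring_scope.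
#[local] Arguments Cconj _%_ring_scope.
#[local] Arguments cos _%_ring_scope.
#[local] Arguments sin _%_ring_scope.
#[local] Delimit Scope R_scope with coqR.

HB.instance Definition _ := gen_eqMixin C.
HB.instance Definition _ := gen_choiceMixin C.

Fact C_addN : left_inverse (RtoC 0%R) Copp Cplus.
Proof. by move=> x; rewrite Cplus_comm Cplus_opp_r. Qed.

HB.instance Definition _ :=
  GRing.isZmodule.Build C Cplus_assoc Cplus_comm Cplus_0_l C_addN.

Fact C_mulDl : left_distributive Cmult Cplus.
Proof. by move=> x y z; rewrite Cmult_plus_distr_r. Qed.

Fact C_one_neq0 : RtoC 1%R != 0 :> C.
Proof. by apply/eqP; exact: C1_nz. Qed.

HB.instance Definition _ := GRing.Zmodule_isComNzRing.Build C
  Cmult_assoc Cmult_comm Cmult_1_l C_mulDl C_one_neq0.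

Fact RtoC_is_additive : zmod_morphism RtoC.
Proof. by move=> x y; rewrite -RminusE RtoC_minus. Qed.
Fact RtoC_is_multiplicative : monoid_morphism RtoC.
Proof. by split=> // x y; rewrite -RmultE RtoC_mult. Qed.

HB.instance Definition _ := GRing.isZmodMorphism.Build R C RtoC RtoC_is_additive.
HB.instance Definition _ := GRing.isMonoidMorphism.Build R C RtoC RtoC_is_multiplicative.

Lemma CpowE (z : C) k : Cpow z k = z ^+ k.
Proof. by elim: k => // k IH; rewrite exprS -IH. Qed.

Lemma sum_nE (u : nat -> C) n : sum_n u n = \sum_(k < n.+1) u k.
Proof.
elim: n => [|n IH]; first by rewrite sum_O big_ord_recl big_ord0 addr0.
by rewrite sum_Sn IH [RHS]big_ord_recr.
Qed.

Lemma Cmod_ler_add (x y : C) : Cmod (x + y) <= Cmod x + Cmod y.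
Proof. by apply/RleP; exact: Cmod_triangle. Qed.
Lemma CmodM (x y : C) : Cmod (x * y) = Cmod x * Cmod y.
Proof. exact: Cmod_mult. Qed.
Lemma CmodX (x : C) k : Cmod (x ^+ k) = Cmod x ^+ k.
Proof. by rewrite -CpowE Cmod_pow RpowE. Qed.
Lemma Cmod_ge0 (x : C) : 0 <= Cmod x.
Proof. by apply/RleP; exact: Cmod_ge_0. Qed.
Lemma CmodR (x : R) : Cmod (RtoC x) = `|x|.
Proof. by rewrite Cmod_R RabsE. Qed.
Lemma CmodN (x : C) : Cmod (- x) = Cmod x.
Proof. exact: Cmod_opp. Qed.

Lemma Cmod_ler_sum (I : Type) (s : seq I) (P : pred I) (u : I -> C) :
  Cmod (\sum_(i <- s | P i) u i) <= \sum_(i <- s | P i) Cmod (u i).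
Proof.
elim/big_rec2: _ => [|i y x _ IH]; first by rewrite Cmod_0.
by apply: le_trans (Cmod_ler_add _ _) _; rewrite lerD2l.
Qed.

Lemma C_addrr_eq0 (x : C) : x + x = 0 -> x = 0.
Proof.
move=> h; apply: Cmod_eq_0.
move: (CmodM 2%:R x); rewrite mulr_natl mulr2n h Cmod_0 => /esym/eqP.
by rewrite -(rmorph_nat RtoC) CmodR mulf_eq0 normr_eq0 pnatr_eq0 /= => /eqP.
Qed.

(** * Averages over roots of unity *)

Definition cis (t : R) : C := (cos t, sin t).

Lemma cisD s t : cis (s + t) = cis s * cis t.
Proof.
rewrite /cis -RplusE cos_plus sin_plus /GRing.mul /= /Cmult /=.
by congr (_, _); rewrite Rplus_comm.
Qed.

Lemma cis0 : cis 0 = 1.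
Proof. by rewrite /cis cos_0 sin_0. Qed.

Lemma cisX t k : cis t ^+ k = cis (k%:R * t).
Proof.
elim: k => [|k IH]; first by rewrite expr0 mul0r cis0.
by rewrite exprS IH -cisD -natr1; congr cis; ring.
Qed.

Lemma Cmod_cis t : Cmod (cis t) = 1.
Proof.
rewrite /Cmod /cis /= !Rmult_1_r; have := sin2_cos2 t; rewrite /Rsqr Rplus_comm => ->.
exact: sqrt_1.
Qed.

Lemma conj_cis t : Cconj (cis t) = cis (- t).
Proof. by rewrite /cis -RoppE cos_neg sin_neg. Qed.

Lemma cis_2PI k : cis (k%:R * (2 * PI)) = 1.
Proof.
rewrite -cisX (_ : cis _ = 1) ?expr1n // /cis.
have -> : 2 * PI = Rmult (IZR 2) PI by rewrite -RmultE.
by rewrite cos_2PI sin_2PI.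
Qed.

Lemma cis_neq1 t : 0 < t < 2 * PI -> cis t <> 1.
Proof.
move=> /andP[t0 t1] /(congr1 fst) /= ct.
have s0 : 0 < sin (t / 2).
  by apply/RltP/sin_gt_0; apply/RltP; rewrite ?RealsE; lra.
have := cos_plus (t / 2) (t / 2); have := sin2_cos2 (t / 2); rewrite /Rsqr !RealsE.
have -> : t / 2 + t / 2 = t by field.
rewrite ct; set s := sin _ in s0 *; set c := cos _ => h1 h2.
have : s * s = 0 by have : (1 : R) = c * c - s * s by []; move: h1; lra.
by move/eqP; rewrite mulf_eq0 orbb gt_eqF.
Qed.

Lemma C_mul_eq0 (x y : C) : x * y = 0 -> x <> 0 -> y = 0.
Proof.
move=> xy x0; apply: Cmod_eq_0; move: (CmodM x y); rewrite xy Cmod_0 => /esym/eqP.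
by rewrite mulf_eq0 => /orP[/eqP /Cmod_eq_0|/eqP].
Qed.

(** The angle of the j-th of the N-th roots of unity. *)
Definition node (N j : nat) : R := j%:R * (2 * PI / N%:R).

(** A geometric sum whose ratio [cis t] is an N-th root of unity, different from 1 unless i = k. *)
Lemma sum_cis_node N i k : (i < N)%N -> (k < N)%N ->
  \sum_(j < N) cis (node N j) ^+ i * cis (- (k%:R * node N j)) = ((i == k) * N)%:R.
Proof.
move=> iN kN; have N0 : N%:R != 0 :> R by rewrite pnatr_eq0 -lt0n (leq_trans _ iN).
pose t : R := (i%:R - k%:R) * (2 * PI / N%:R).
have -> : \sum_(j < N) cis (node N j) ^+ i * cis (- (k%:R * node N j))
    = \sum_(j < N) cis t ^+ j.
  by apply: eq_bigr => j _; rewrite !cisX -cisD; congr cis; rewrite /node /t; ring.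
case: eqVneq => [e|ik].
  rewrite /t e subrr mul0r cis0 mul1n; under eq_bigr do rewrite expr1n.
  by rewrite sumr_const card_ord.
have tN : cis t ^+ N = 1.
  have -> : cis t = cis (i%:R * (2 * PI / N%:R)) * cis (- (k%:R * (2 * PI / N%:R))).
    by rewrite -cisD; congr cis; rewrite /t; ring.
  have e m : N%:R * (m%:R * (2 * PI / N%:R)) = m%:R * (2 * PI) :> R by field.
  by rewrite exprMn !cisX e cis_2PI mul1r mulrN e -conj_cis cis_2PI /Cconj /=
    RoppE oppr0.
have P0 : 0 < PI by apply/RltP; exact: PI_RGT_0.
have Npos : 0 < N%:R :> R by rewrite ltr0n (leq_trans _ iN).
have lt_2PI m : (0 < m < N)%N -> 0 < m%:R * (2 * PI / N%:R) < 2 * PI.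
  move=> /andP[m0 mN]; have q0 : 0 < 2 * PI / N%:R by rewrite divr_gt0 //; lra.
  apply/andP; split; first by apply: mulr_gt0; rewrite ?ltr0n.
  by rewrite mulrA ltr_pdivrMr // mulrC ltr_pM2l ?ltr_nat //; lra.
have t1 : 1 - cis t <> 0.
  move/eqP; rewrite subr_eq0 eq_sym => /eqP.
  have [lt_ik|lt_ki|e] := ltngtP i k; last by rewrite e eqxx in ik.
    (* A negative angle is conjugated so that [cis_neq1] applies. *)
    move=> /(congr1 Cconj); rewrite conj_cis (_ : - t = (k - i)%:R * (2 * PI / N%:R)).
      rewrite /Cconj /= RoppE oppr0; apply: cis_neq1; apply: lt_2PI; lia.
    by rewrite natrB ?(ltnW lt_ik) // /t; ring.
  rewrite (_ : t = (i - k)%:R * (2 * PI / N%:R)).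
    by apply: cis_neq1; apply: lt_2PI; lia.
  by rewrite natrB ?(ltnW lt_ki) // /t; ring.
apply: (C_mul_eq0 _ t1).
have := subrX1 (cis t) N; rewrite tN subrr => e.
by rewrite -opprB mulNr -e oppr0.
Qed.

(** The degree is below the number of nodes, so there is no aliasing and the discrete mean is exact;
    it takes the place of Cauchy's integral. *)
Lemma coef_mean_eq (P : {poly C}) N k : (size P <= N)%N -> (k < N)%N ->
  \sum_(j < N) P.[cis (node N j)] * cis (- (k%:R * node N j)) = N%:R * P`_k.
Proof.
move=> sP kN; under eq_bigr => j _ do rewrite (horner_coef_wide _ sP) mulr_suml.
rewrite exchange_big /= (bigD1 (Ordinal kN)) //= [X in _ + X]big1 => [|i ik].
  under eq_bigr => j _ do rewrite -mulrA.
  by rewrite -mulr_sumr sum_cis_node // eqxx mul1n addr0 mulrC.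
under eq_bigr => j _ do rewrite -mulrA.
rewrite -mulr_sumr sum_cis_node // (_ : (i == k :> nat) = false) ?mul0n ?mulr0 //.
by apply: contraNF ik => /eqP e; apply/eqP/val_inj.
Qed.

Lemma CmodN_nat n : Cmod n%:R = n%:R.
Proof. by rewrite -(rmorph_nat RtoC) CmodR normr_nat. Qed.

Lemma coef_le_mean (P : {poly C}) N k : (size P <= N)%N ->
  N%:R * Cmod P`_k <= \sum_(j < N) Cmod P.[cis (node N j)].
Proof.
move=> sP; have [Nk|kN] := leqP N k.
  rewrite nth_default ?(leq_trans sP) // Cmod_0 mulr0.
  by apply: sumr_ge0 => j _; exact: Cmod_ge0.
rewrite -CmodN_nat -CmodM -(coef_mean_eq sP kN).
apply: le_trans (Cmod_ler_sum _ _ _) _.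
by apply: ler_sum => j _; rewrite CmodM Cmod_cis mulr1.
Qed.

Lemma cauchy_estimate (P : {poly C}) (M : R) k :
  (forall t, Cmod P.[cis t] <= M) -> Cmod P`_k <= M.
Proof.
move=> PM; rewrite -(ler_pM2l (ltr0Sn _ (size P))).
apply: le_trans (coef_le_mean k (leqnSn _)) _.
apply: (@le_trans _ _ (\sum_(j < (size P).+1) M)); first by apply: ler_sum => j _.
by rewrite sumr_const card_ord mulr_natl.
Qed.

Lemma sum_geom_le (q : R) n : 0 <= q -> q < 1 -> \sum_(i < n) q ^+ i <= (1 - q)^-1.
Proof.
move=> q0 q1; have p1 : 0 < 1 - q by lra.
rewrite -[leRHS]mul1r ler_pdivlMr // mulrC -opprB mulNr -subrX1 opprB.
by rewrite lerBlDr lerDl exprn_ge0.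
Qed.

(* The Cauchy estimates for P ^+ m lose a factor (1 - |z|)^-1 that does not depend
   on m. *)
Lemma poly_max_principle (P : {poly C}) (M : R) z :
  (forall t, Cmod P.[cis t] <= M) -> Cmod z < 1 -> Cmod P.[z] <= M.
Proof.
move=> PM z1; have M0 : 0 <= M := le_trans (Cmod_ge0 _) (PM 0).
apply/RleP; apply: (@le_of_pow_le _ _ ((1 - Cmod z)^-1)%R); first exact/RleP.
move=> m; apply/RleP; rewrite !RealsE -CmodX -horner_exp horner_coef.
apply: le_trans (Cmod_ler_sum _ _ _) _.
apply: (@le_trans _ _ (\sum_(i < size (P ^+ m)) M ^+ m * Cmod z ^+ i)).
  apply: ler_sum => i _; rewrite CmodM CmodX ler_wpM2r ?exprn_ge0 ?Cmod_ge0 //.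
  by apply: cauchy_estimate => t; rewrite horner_exp CmodX lerXn2r ?nnegrE ?Cmod_ge0.
by rewrite -mulr_sumr ler_wpM2l ?exprn_ge0 ?sum_geom_le ?Cmod_ge0.
Qed.

Lemma poly_bound_ex (P : {poly C}) :
  exists2 K : R, 0 <= K & forall z, Cmod z <= 1 -> Cmod P.[z] <= K.
Proof.
exists (\sum_(i < size P) Cmod P`_i) => [|z z1].
  by apply: sumr_ge0 => i _; exact: Cmod_ge0.
rewrite horner_coef; apply: le_trans (Cmod_ler_sum _ _ _) _.
apply: ler_sum => i _; rewrite CmodM CmodX -[leRHS]mulr1 ler_wpM2l ?Cmod_ge0 //.
by rewrite exprn_ile1 ?Cmod_ge0.
Qed.

(** The root of P - P(1) at 1 is factored out, and the quotient is bounded on the closed disk. *)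
Lemma poly_diff_at1 (P : {poly C}) : exists2 K : R, 0 <= K &
  forall x : R, 0 <= x <= 1 -> Cmod (P.[1] - P.[RtoC x]) <= (1 - x) * K.
Proof.
have : root (P - P.[1]%:P) 1 by rewrite rootE !hornerE subrr.
case/factor_theorem => Q PQ; have [K K0 QK] := poly_bound_ex Q.
exists K => // x /andP[x0 x1].
have -> : P.[1] - P.[RtoC x] = RtoC (1 - x) * Q.[RtoC x].
  have := congr1 (fun p : {poly C} => p.[RtoC x]) PQ; rewrite !hornerE => e.
  by rewrite -opprB e rmorphB rmorph1; ring.
rewrite CmodM CmodR ger0_norm ?subr_ge0 // ler_wpM2l ?subr_ge0 // QK //.
by rewrite CmodR ger0_norm.
Qed.

Lemma le_of_le_eps (x y K : R) : 0 <= K ->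
  (forall e, 0 < e -> e < 1 -> x <= y + e * K) -> x <= y.
Proof.
move=> K0 h; rewrite leNgt; apply/negP => yx.
(* The factor 2 keeps e K below x - y, and K + 1 avoids division by 0. *)
pose e := Num.min (1 / 2) ((x - y) / (2 * (K + 1))).
have e0 : 0 < e by rewrite lt_min !divr_gt0 //; lra.
have e1 : e < 1 by rewrite gt_min; apply/orP; left; lra.
have e2 : e * (K + 1) <= (x - y) / 2.
  have -> : (x - y) / 2 = (x - y) / (2 * (K + 1)) * (K + 1) by field; lra.
  by rewrite ler_wpM2r ?ge_min ?lexx ?orbT //; lra.
have := h e e0 e1; nra.
Qed.

(** The passage to the radial limit at 1, by which dilations are undone. *)
Lemma poly_le_at1 (P Q : {poly C}) :
  (forall x : R, 0 < x < 1 -> Cmod P.[RtoC x] <= Cmod Q.[RtoC x]) ->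
  Cmod P.[1] <= Cmod Q.[1].
Proof.
move=> PQ; have [K K0 PK] := poly_diff_at1 P; have [K' K'0 QK] := poly_diff_at1 Q.
apply: (@le_of_le_eps _ _ (K + K')); first exact: addr_ge0.
move=> e e0 e1; have x01 : 0 <= 1 - e <= 1 by apply/andP; split; lra.
have := PK _ x01; have := QK _ x01.
have e01 : 0 < 1 - e < 1 by apply/andP; split; lra.
have := PQ _ e01; set p := P.[RtoC _]; set q := Q.[RtoC _].
have := Cmod_ler_add (P.[1] - p) p; have := Cmod_ler_add (- (Q.[1] - q)) Q.[1].
rewrite CmodN subrK opprB subrK; nra.
Qed.

(** * Coefficients of bounded power series *)

Definition dilated_poly (a : nat -> C) (rho : R) (L : nat) : {poly C} :=
  \poly_(k < L.+1) (a k * RtoC rho ^+ k).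

(** Dilation by rho < r brings the closed unit disk into the region of uniform approximation. *)
Lemma dilated_poly_approx (r rho eps : R) (a : nat -> C) (f : C -> C) (m : nat) :
  power_series_on r a f -> 0 <= rho < r -> 0 < eps ->
  exists2 L, (m <= L)%N &
    forall z, Cmod z <= 1 -> Cmod (f (RtoC rho * z) - (dilated_poly a rho L).[z]) <= eps.
Proof.
move=> fa /andP[/RleP rho0 /RltP rho1] /RltP eps0.
have [L [mL hL]] := @power_series_approx r rho eps a f m fa (conj rho0 rho1) eps0.
exists L => [|z z1]; first by lia.
have -> : (dilated_poly a rho L).[z] = sum_n (fun k => a k * (RtoC rho * z)^k)%C L.
  rewrite sum_nE horner_poly; apply: eq_bigr => k _.
  by rewrite CpowE exprMn -mulrA.
apply/RleP/hL/RleP; rewrite CmodM CmodR ger0_norm; last exact/RleP.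
by rewrite -[leRHS]mulr1 ler_wpM2l //; apply/RleP.
Qed.

Lemma sum_dilate_le (u : nat -> C) n (B : R) :
  (forall x : R, 0 < x < 1 -> Cmod (\sum_(i < n.+1) u i * RtoC x ^+ i) <= B) ->
  Cmod (\sum_(i < n.+1) u i) <= B.
Proof.
move=> h; have B0 : 0 <= B.
  have h2 : 0 < (1 / 2 : R) < 1 by apply/andP; split; lra.
  exact: le_trans (Cmod_ge0 _) (h _ h2).
have := @poly_le_at1 (\poly_(i < n.+1) u i) (RtoC B)%:P; rewrite hornerC CmodR ger0_norm //.
rewrite horner_poly; under eq_bigr => i _ do rewrite expr1n mulr1.
by apply => x x01; rewrite hornerC CmodR ger0_norm // horner_poly h.
Qed.

(** The sum is the n-th coefficient of f U. A polynomial p close to f(x z) on the closed disk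
    replaces f, and the mean over more than size (p U) nodes bounds the coefficient by (1 + e) B;
    then e -> 0 and x -> 1. The size of p depends on e and x, hence the means of U at arbitrarily
    large N. *)
Lemma schur_coef_bound (f : C -> C) (a : nat -> C) (U : {poly C}) n (B : R) :
    power_series_on 1 a f -> (forall z, Cmod z < 1 -> Cmod (f z) <= 1) ->
    (forall N0, exists2 N, (N0 < N)%N &
       \sum_(j < N) Cmod U.[cis (node N j)] <= N%:R * B) ->
  Cmod (\sum_(i < n.+1) a i * U`_(n - i)) <= B.
Proof.
move=> fa f1 mean; have B0 : 0 <= B.
  have [N N0 h] := mean 0%N; rewrite -(pmulr_rge0 _ (_ : 0 < N%:R)) ?ltr0n //.
  by apply: le_trans h; apply: sumr_ge0 => j _; exact: Cmod_ge0.
apply: (@sum_dilate_le (fun i => a i * U`_(n - i))) => x /andP[x0 x1].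
apply: (@le_of_le_eps _ _ B B0) => e e0 _.
have [L nL hL] : exists2 L, (n <= L)%N & forall z, Cmod z <= 1 ->
    Cmod (f (RtoC x * z) - (dilated_poly a x L).[z]) <= e.
  by apply: dilated_poly_approx fa _ e0; rewrite x1 ltW.
set p := dilated_poly a x L in hL.
have [N N0 hN] := mean (size (p * U)).
have -> : \sum_(i < n.+1) a i * U`_(n - i) * RtoC x ^+ i = (p * U)`_n.
  rewrite coefM; apply: eq_bigr => i _; rewrite coef_poly ifT; first by rewrite mulrAC.
  by rewrite ltnS (leq_trans _ nL) // -ltnS.
have Npos : 0 < N%:R :> R by rewrite ltr0n (leq_ltn_trans _ N0).
rewrite -(ler_pM2l Npos); apply: le_trans (coef_le_mean n (ltnW N0)) _.
apply: (@le_trans _ _ (\sum_(j < N) (1 + e) * Cmod U.[cis (node N j)])).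
  apply: ler_sum => j _; rewrite hornerM CmodM ler_wpM2r ?Cmod_ge0 //.
  set z := cis _; have z1 : Cmod z <= 1 by rewrite Cmod_cis.
  have xz1 : Cmod (RtoC x * z) < 1 by rewrite CmodM Cmod_cis mulr1 CmodR ger0_norm ?ltW.
  have := Cmod_ler_add (f (RtoC x * z)) (- (f (RtoC x * z) - p.[z])).
  have -> : f (RtoC x * z) + - (f (RtoC x * z) - p.[z]) = p.[z] by ring.
  rewrite CmodN; have := hL z z1; have := f1 _ xz1; lra.
rewrite -mulr_sumr; apply: le_trans (ler_wpM2l _ hN) _; first lra.
by rewrite mulrCA mulrDl mul1r.
Qed.

Lemma coef_dilated_poly a rho L k :
  (dilated_poly a rho L)`_k = if (k <= L)%N then a k * RtoC rho ^+ k else 0.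
Proof. by rewrite coef_poly ltnS. Qed.

(** * Taylor coefficients of the branch *)

Lemma power_series_at0 r a f : 0 < r -> power_series_on r a f -> f 0 = a 0%N.
Proof.
move=> r0 fa; apply/eqP; rewrite -subr_eq0; apply/eqP/Cmod_eq_0/le_anti.
apply/andP; split; last exact: Cmod_ge0.
apply: (@le_of_le_eps _ _ 1) => // e e0 _.
(* Dilation by 0 leaves only the constant term. *)
have [L _ hL] : exists2 L, (0 <= L)%N & forall z, Cmod z <= 1 ->
    Cmod (f (RtoC 0 * z) - (dilated_poly a 0 L).[z]) <= e.
  by apply: dilated_poly_approx fa _ e0; rewrite lexx.
have := hL 0; rewrite mulr0 horner_coef0 coef_dilated_poly mulr1 Cmod_0.
by rewrite ler01 RealsE add0r mulr1; apply.
Qed.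

(** On the circle of radius rho the square of a section p is close to g^2 = 1 + w + w^2, so a Cauchy
    estimate for p^2 - q compares the coefficients. *)
Lemma sqrt_branch_conv r g b : 0 < r -> sqrt_branch r g -> power_series_on r b g ->
  (b : fps C) * (b : fps C) = 1 + fpsX C 1 + fpsX C 2.
Proof.
move=> r0 [_ [gsq _]] gb; apply/funext => m.
pose rho := Num.min (r / 2) 1.
have rho0 : 0 < rho by rewrite lt_min divr_gt0 //= ltr01.
have rho1 : rho <= 1 by rewrite ge_min lexx orbT.
have rhor : rho < r by rewrite gt_min; apply/orP; left; lra.
have -> : (1 + fpsX C 1 + fpsX C 2) m = (m <= 2)%N%:R.
  by rewrite !fpsD fps1 /fpsX; case: m => [|[|[|m]]] //=; rewrite ?addr0 ?add0r.
have rhom : RtoC rho ^+ m <> 0.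
  move=> /(congr1 Cmod); rewrite CmodX CmodR Cmod_0 => /eqP; rewrite RealsE.
  by rewrite expf_eq0 normr_eq0 gt_eqF // andbF.
apply/eqP; rewrite -subr_eq0; apply/eqP.
apply: (C_mul_eq0 _ rhom); apply: Cmod_eq_0; apply/le_anti/andP.
split; last exact: Cmod_ge0.
(* Here |g| <= 2 and e < 1, so |p^2 - g^2| <= e (e + 4) <= 5 e. *)
apply: (@le_of_le_eps _ _ 5) => // e e0 e1.
have [L mL hL] : exists2 L, (m <= L)%N & forall z, Cmod z <= 1 ->
    Cmod (g (RtoC rho * z) - (dilated_poly b rho L).[z]) <= e.
  by apply: dilated_poly_approx gb _ e0; rewrite rhor ltW.
set p := dilated_poly b rho L in hL.
pose q := dilated_poly (fun=> 1) rho 2.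
have -> : RtoC rho ^+ m * (((b : fps C) * (b : fps C)) m - (m <= 2)%N%:R) = (p * p - q)`_m.
  rewrite coefB coefM coef_dilated_poly mulrBr fpsM mulr_sumr; congr (_ - _).
    apply: eq_bigr => i _; have im : (i <= m)%N by rewrite -ltnS.
    rewrite !coef_dilated_poly !ifT ?(leq_trans _ mL) ?leq_subr //.
    by rewrite -{1}(subnKC im) exprD; ring.
  by case: ifP => _; rewrite ?mulr0 // mul1r mulr1.
rewrite RealsE add0r; apply: cauchy_estimate => t.
have zt : Cmod (cis t) <= 1 by rewrite Cmod_cis.
have wt : Cmod (RtoC rho * cis t) <= rho by rewrite CmodM Cmod_cis mulr1 CmodR gtr0_norm.
set w := RtoC rho * cis t in wt *.
have qw : q.[cis t] = g w * g w.
  have -> : g w * g w = 1 + w + w ^+ 2.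
    have := gsq w; rewrite !CpowE -expr2 => h; apply: h; apply/RltP.
    by apply: le_lt_trans rhor.
  by rewrite /q /dilated_poly horner_poly !big_ord_recl big_ord0 /= /w; ring.
have gw : Cmod (g w) <= 2.
  have : Cmod (g w) * Cmod (g w) <= 3.
    rewrite -CmodM -qw /q horner_poly; apply: le_trans (Cmod_ler_sum _ _ _) _.
    apply: (@le_trans _ _ (\sum_(i < 3) 1)); last by rewrite sumr_const card_ord.
    apply: ler_sum => i _; rewrite mul1r CmodM !CmodX Cmod_cis expr1n mulr1.
    by rewrite CmodR gtr0_norm // exprn_ile1 // ltW.
  by have := Cmod_ge0 (g w); nra.
have := hL _ zt; rewrite -/w => hpg.
rewrite hornerD hornerN hornerM qw.
have -> : p.[cis t] * p.[cis t] - g w * g w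
  = (g w - p.[cis t]) * ((g w - p.[cis t]) - (g w + g w)) by ring.
rewrite CmodM; have := Cmod_ler_add (g w - p.[cis t]) (- (g w + g w)).
have := Cmod_ler_add (g w) (g w); rewrite CmodN.
have := Cmod_ge0 (g w - p.[cis t]); have := Cmod_ge0 (g w - p.[cis t] - (g w + g w)).
set A := Cmod (_ - _ - _); set B := Cmod (_ - _) in hpg *; nra.
Qed.

(** The factor a + b of a^2 - b^2 has constant term 2, so a - b vanishes coefficient by
    coefficient. *)
Lemma fps_sqrt_unique (a b : fps C) :
  a * a = b * b -> a 0%N = 1 -> b 0%N = 1 -> a = b.
Proof.
move=> ab a0 b0; apply/funext; elim/ltn_ind => k IH.
have : ((a - b) * (a + b)) k = 0.
  by have -> : (a - b) * (a + b) = a * a - b * b; [ring | rewrite ab subrr].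
rewrite fpsM big_ord_recr big1 /= => [|i _]; last first.
  by rewrite (fpsB a b) IH ?ltn_ord // subrr mul0r.
rewrite add0r subnn (fpsD a b) (fpsB a b) a0 b0 mulrDr mulr1 => /C_addrr_eq0 /eqP.
by rewrite subr_eq0 => /eqP.
Qed.

Definition fps_RtoC (a : fps R) : fps C := fun k => RtoC (a k).

Lemma fps_RtoC_M a b : fps_RtoC (a * b) = fps_RtoC a * fps_RtoC b.
Proof.
apply/funext => k; rewrite /fps_RtoC fpsM rmorph_sum.
by apply: eq_bigr => i _; rewrite rmorphM.
Qed.

Lemma sqrt_branch_coef r g b : 0 < r -> sqrt_branch r g -> power_series_on r b g ->
  b = fps_RtoC (sqrt_tri R).
Proof.
move=> r0 gS gb; apply: fps_sqrt_unique.
- rewrite (sqrt_branch_conv r0 gS gb) -fps_RtoC_M sqrt_tri_sqr.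
  apply/funext => k; rewrite /fps_RtoC !fpsD !fps1 /fpsX !rmorphD.
  by rewrite !rmorph_nat.
- by rewrite -(power_series_at0 r0 gb); case: gS => _ [].
- by rewrite /fps_RtoC sqrt_tri0.
Qed.

(** On the circle 1 + z + z^2 = z (1 + 2 cos t). The number of nodes is a multiple of 3, as in
    [sum_abs_1_2cos]. *)
Lemma mean_tri N0 : exists2 N, (N0 < N)%N &
  \sum_(j < N) Cmod (\poly_(k < 3) (1 : C)).[cis (node N j)] <= N%:R * tri_mean.
Proof.
exists (3 * N0.+1)%N; first by lia.
have := @sum_abs_1_2cos N0.+1 (ssrnat.ltP (ltn0Sn N0)).
have -> : PeanoNat.Nat.sub (PeanoNat.Nat.mul 3 N0.+1) 1 = (3 * N0.+1).-1 by lia.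
move=> /RleP; rewrite sum_f_R0E prednK ?muln_gt0 // big_mkord.
have -> : (IZR 3 * INR N0.+1 * tri_mean)%coqR = (3 * N0.+1)%:R * tri_mean.
  by rewrite !RealsE natrM.
apply: le_trans; apply: ler_sum => j _; set t := node _ j.
have -> : (INR j * (2 * PI / (3 * INR N0.+1)))%coqR = t.
  by rewrite /t /node !RealsE natrM.
rewrite horner_poly !big_ord_recl big_ord0 !mul1r addr0 expr0 expr1 /=.
have -> : 1 + (cis t + cis t ^+ 2) = cis t * RtoC (1 + 2 * cos t).
  have -> : RtoC (1 + 2 * cos t) = 1 + (cis t + cis (- t)).
    rewrite /cis -RoppE cos_neg sin_neg.
    by rewrite /GRing.add /= /Cplus /RtoC /=; congr (_, _); rewrite ?RealsE; ring.
  have e : cis t * cis (- t) = 1 by rewrite -cisD subrr cis0.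
  by rewrite !mulrDr mulr1 e; ring.
by rewrite CmodM Cmod_cis mul1r CmodR !RealsE.
Qed.

(** * Reciprocal polynomials and Parseval's identity *)

Definition rpoly (a : nat -> R) n : {poly C} := \poly_(k < n.+1) RtoC (a k).
Definition rpoly_rev (a : nat -> R) n : {poly C} := \poly_(k < n.+1) RtoC (a (n - k)%N).

Lemma rpoly_revE a n z : (rpoly_rev a n).[z] = \sum_(k < n.+1) RtoC (a k) * z ^+ (n - k).
Proof.
rewrite horner_poly (reindex_inj rev_ord_inj) /=; apply: eq_bigr => k _.
by rewrite subSS subKn // -ltnS.
Qed.

Lemma Cconj_RtoC (x : R) : Cconj (RtoC x) = RtoC x.
Proof. by rewrite /Cconj /RtoC /= RoppE oppr0. Qed.

(** Conjugation on the circle is inversion, and the coefficients are real. *)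
Lemma conj_rpoly a n t :
  Cconj (rpoly a n).[cis t] = (rpoly_rev a n).[cis t] * cis (- (n%:R * t)).
Proof.
rewrite rpoly_revE horner_poly mulr_suml (big_morph Cconj Cplus_conj (Cconj_RtoC 0)).
  apply: eq_bigr => k _; have kn : (k <= n)%N by rewrite -ltnS.
  rewrite (_ : Cconj _ = RtoC (a k) * cis (- (k%:R * t))).
    rewrite -mulrA cisX -cisD; congr (_ * cis _).
    by rewrite natrB //; ring.
  by rewrite [LHS]Cmult_conj cisX conj_cis; congr Cmult; exact: Cconj_RtoC.
Qed.

Lemma Cmod_rpoly_rev a n t : Cmod (rpoly_rev a n).[cis t] = Cmod (rpoly a n).[cis t].
Proof. by rewrite -(Cmod_conj (rpoly a n).[_]) conj_rpoly CmodM Cmod_cis mulr1. Qed.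

Lemma coef_rpolyM_rev a n :
  (rpoly a n * rpoly_rev a n)`_n = RtoC (\sum_(k < n.+1) a k ^+ 2).
Proof.
rewrite coefM rmorph_sum; apply: eq_bigr => k _; have kn : (k <= n)%N by rewrite -ltnS.
by rewrite !coef_poly !ltnS kn leq_subr subKn // rmorphXn expr2.
Qed.

(** On the circle |T^2| = T conj(T) = z^(-n) T T^*, so the mean is the n-th coefficient of T T^*,
    exactly once N exceeds the degree 2n. *)
Lemma rpoly_parseval a n N : (n.*2 < N)%N ->
  \sum_(j < N) Cmod (rpoly a n * rpoly a n).[cis (node N j)]
    = N%:R * \sum_(k < n.+1) a k ^+ 2.
Proof.
move=> nN; apply: (@RtoC_inj _ _); rewrite rmorphM rmorph_nat /= -coef_rpolyM_rev.
rewrite -coef_mean_eq; last by lia.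
  rewrite rmorph_sum; apply: eq_bigr => j _; rewrite !hornerM CmodM -mulrA -conj_rpoly.
  by have := Cmod2_conj (rpoly a n).[cis (node N j)]; rewrite RpowE expr2.
apply: leq_trans (size_polyMleq _ _) _.
have h1 : (size (rpoly a n) <= n.+1)%N := size_poly _ _.
have h2 : (size (rpoly_rev a n) <= n.+1)%N := size_poly _ _.
lia.
Qed.

(** * Convergent series multiplied by polynomials *)

Definition fps_poly (P : {poly C}) : fps C := fun k => P`_k.

Lemma fps_polyM P Q : fps_poly (P * Q) = fps_poly P * fps_poly Q.
Proof. by apply/funext => k; rewrite /fps_poly coefM fpsM. Qed.

Lemma fps_poly_rpoly a n : fps_poly (rpoly a n) = fps_RtoC (fps_cut n a).
Proof.
apply/funext => k; rewrite /fps_poly coef_poly /fps_RtoC /fps_cut ltnS.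
by case: ifP.
Qed.

Notation C_is_series := (@is_series C_AbsRing C_NormedModule).

Lemma is_series_fps_one z : C_is_series (fun k => (1 : fps C) k * z ^+ k) 1.
Proof.
apply: (filterlim_ext (fun=> (1 : C))); last exact: filterlim_const.
move=> n; rewrite sum_nE big_ord_recl fps1 mul1r big1 ?addr0 // => i _.
by rewrite fps1 mul0r.
Qed.

(** Horner induction on P: a factor z shifts the series, a constant scales it. *)
Lemma is_series_fps_polyM P (u : fps C) z l :
  C_is_series (fun k => u k * z ^+ k) l ->
  C_is_series (fun k => (fps_poly P * u) k * z ^+ k) (P.[z] * l).
Proof.
move=> ul; elim/poly_ind: P => [|P c IH].
  apply: (is_series_ext (fun k => scal (0 : C) (u k * z ^+ k : C_NormedModule))).
    move=> k; rewrite /scal /= /mult /=; rewrite [LHS]Cmult_0_l.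
    rewrite fpsM big1 => [|i _]; last by rewrite /fps_poly coef0 mul0r.
    by rewrite mul0r.
  by rewrite horner0; apply: is_series_scal ul.
rewrite hornerMXaddC mulrDl.
have -> : (fun k => (fps_poly (P * 'X + c%:P) * u) k * z ^+ k)
  = (fun k => plus (if k is j.+1 then z * ((fps_poly P * u) j * z ^+ j) else 0 : C_NormedModule)
             (scal c (u k * z ^+ k : C_NormedModule))).
  apply/funext => k; have -> : fps_poly (P * 'X + c%:P)
      = fpsX C 1 * fps_poly P + (fun j => if j == 0%N then c else 0).
    apply/funext => j; rewrite (fpsD (_ * _)) /= (fpsXM 1) /fps_poly coefD coefMX coefC.
    by case: j => [|j] //=; rewrite subn1.
  rewrite mulrDl (fpsD (_ * _)) mulrDl; congr (_ + _).
    rewrite -mulrA (fpsXM 1); case: k => [|k] /=; first by rewrite mul0r.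
    by rewrite subn1 exprS /=; ring.
  rewrite fpsM big_ord_recl big1 /= => [|i _]; last by rewrite mul0r.
  by rewrite addr0 subn0 -mulrA.
apply: is_series_plus; last exact: is_series_scal.
apply: is_series_decr_1; rewrite /opp /= /plus /= Copp_0 Cplus_0_r.
rewrite [P.[z] * z]mulrC -mulrA; exact: (is_series_scal z).
Qed.

(** * The bound for sections and the extremal function *)

Definition tri_sum n : R := \sum_(k < n.+1) sqrt_tri R k ^+ 2.

Lemma coef_sqrt_tri_sqr n j : (j <= n)%N ->
  (rpoly (sqrt_tri R) n * rpoly (sqrt_tri R) n)`_j = (j < 3)%N%:R.
Proof.
move=> jn; have -> : (rpoly (sqrt_tri R) n * rpoly (sqrt_tri R) n)`_j
    = fps_poly (rpoly (sqrt_tri R) n * rpoly (sqrt_tri R) n) j by [].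
rewrite fps_polyM !fps_poly_rpoly -fps_RtoC_M /fps_RtoC fps_cutM_low // mulrC.
rewrite fps_cutM_low // sqrt_tri_sqr !fpsD fps1 /fpsX -(rmorph_nat RtoC); congr RtoC.
by case: j jn => [|[|[|j]]] _; rewrite /= ?addr0 ?add0r.
Qed.

(** [U] begins as 1 + z + z^2, so the convolution reads off the last three coefficients. It serves
    for both U = T^2 and U = 1 + z + z^2. *)
Lemma sum_coef_tri (a : nat -> C) (U : {poly C}) m :
  (forall j, (j <= m.+2)%N -> U`_j = (j < 3)%N%:R) ->
  \sum_(i < m.+3) a i * U`_(m.+2 - i) = a m + a m.+1 + a m.+2.
Proof.
move=> hU; rewrite 3!big_ord_recr big1 /= => [|i _]; last first.
  by rewrite hU ?leq_subr // (_ : (_ < 3)%N = false) ?mulr0 //; have := ltn_ord i; lia.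
rewrite subnn subSnn (_ : (m.+2 - m = 2)%N) ?hU //; last by lia.
by rewrite !mulr1 add0r.
Qed.

Lemma coeff_sectionE (a : nat -> C) m z :
  coeff_section a (m.+2 - 2) m.+2 z = a m * z ^+ m + a m.+1 * z ^+ m.+1 + a m.+2 * z ^+ m.+2.
Proof.
rewrite /coeff_section subn2 /=.
by rewrite sum_n_Sm; [rewrite sum_n_Sm; [rewrite sum_n_n !CpowE | lia] | lia].
Qed.

(** For fixed z the three terms are coefficients of y -> f(z y), again bounded by 1;
    [schur_coef_bound] applies with U = T^2, whose means are given by Parseval. *)
Lemma coeff_section_le (f : C -> C) (a : nat -> C) m z :
    power_series_on 1 a f -> (forall z, Cmod z < 1 -> Cmod (f z) <= 1) -> Cmod z < 1 ->
  Cmod (coeff_section a (m.+2 - 2) m.+2 z) <= tri_sum m.+2.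
Proof.
move=> fa f1 z1; rewrite coeff_sectionE.
have zy y : Cmod y < 1 -> Cmod (z * y) < 1.
  by move=> y1; rewrite CmodM mulr_ilt1 ?Cmod_ge0.
rewrite -(sum_coef_tri (fun k => a k * z ^+ k) (@coef_sqrt_tri_sqr m.+2)).
apply: (@schur_coef_bound (fun y => f (z * y)) (fun k => a k * z ^+ k)).
- move=> y /RltP/zy/RltP/fa; apply: is_series_ext => k.
  rewrite !CpowE; change (a k * (z * y) ^+ k = a k * z ^+ k * y ^+ k).
  by rewrite exprMn mulrA.
- by move=> y /zy/f1.
move=> N0; exists (N0 + m.+2.*2.+1)%N; first by lia.
by rewrite rpoly_parseval //; lia.
Qed.

Lemma sup_one_bound (f : C -> C) :
  Rbar_le (supnorm f) (Rbar.Finite (IZR 1)) -> forall z, Cmod z < 1 -> Cmod (f z) <= 1.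
Proof.
move=> h z /RltP z1; apply/RleP.
have [ub _] := Lub_Rbar_correct (fun x : R => exists z : C, Rlt (Cmod z) (IZR 1) /\ x = Cmod (f z)).
have h1 := ub (Cmod (f z)) (ex_intro _ z (conj z1 erefl)).
exact: (Rbar_le_trans _ _ _ h1 h).
Qed.

Lemma supnorm_le (f : C -> C) (M : R) :
  (forall z, Cmod z < 1 -> Cmod (f z) <= M) -> Rbar_le (supnorm f) (Rbar.Finite M).
Proof.
move=> h; have [_] := Lub_Rbar_correct
  (fun x : R => exists z : C, Rlt (Cmod z) (IZR 1) /\ x = Cmod (f z)).
by apply=> _ [z [/RltP z1 ->]]; apply/RleP/h.
Qed.

Lemma rpoly_tri_inverse n : exists2 w : fps C,
  fps_poly (rpoly (sqrt_tri R) n) * w = 1 & forall k, Cmod (w k) <= 2.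
Proof.
have [w Tw w2] := cut_sqrt_tri_inverse R n; exists (fps_RtoC w) => [|k].
  rewrite fps_poly_rpoly -fps_RtoC_M Tw; apply/funext => k.
  by rewrite /fps_RtoC !fps1 rmorph_nat.
by rewrite CmodR.
Qed.

(** Bounded coefficients make the formal inverse converge in the disk; there T(z) times its sum is
    1, which excludes a zero. *)
Lemma rpoly_tri_inverse_series n (w : fps C) z :
    fps_poly (rpoly (sqrt_tri R) n) * w = 1 -> (forall k, Cmod (w k) <= 2) -> Cmod z < 1 ->
  (rpoly (sqrt_tri R) n).[z] <> 0 /\
  C_is_series (fun k => w k * z ^+ k) (Cinv (rpoly (sqrt_tri R) n).[z]).
Proof.
move=> Tw w2 /RltP z1; have [l] := ex_series_bounded_coeff w _ z (fun k => elimT RleP (w2 k)) z1.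
move=> /(is_series_ext _ (fun k => w k * z ^+ k)) wl.
have {}wl : C_is_series (fun k => w k * z ^+ k) l by apply: wl => k; rewrite CpowE.
have := @is_series_fps_polyM (rpoly (sqrt_tri R) n) _ _ _ wl; rewrite Tw => h.
have e : (rpoly (sqrt_tri R) n).[z] * l = 1.
  exact: is_series_C_unique h (is_series_fps_one z).
have T0 : (rpoly (sqrt_tri R) n).[z] <> 0.
  by move=> h0; move: e; rewrite h0 mul0r => /esym/eqP; rewrite oner_eq0.
split=> //; suff -> : Cinv (rpoly (sqrt_tri R) n).[z] = l by [].
have e' : Cmult (rpoly (sqrt_tri R) n).[z] l = RtoC (IZR 1) by [].
by rewrite -[LHS]Cmult_1_r -e' Cmult_assoc Cinv_l // Cmult_1_l.
Qed.

Lemma horner_rpoly_dilate a (x : R) n z :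
  (rpoly (fun k => a k * x ^+ k) n).[z] = (rpoly a n).[RtoC x * z].
Proof.
rewrite !horner_poly; apply: eq_bigr => k _.
by rewrite rmorphM rmorphXn exprMn mulrA.
Qed.

(* On the unit circle the reversed polynomial has the same modulus as the polynomial;
   dilating first makes the quotient a uniform limit of polynomials on the closed disk. *)
Lemma rpoly_rev_le n z : Cmod z < 1 ->
  Cmod (rpoly_rev (sqrt_tri R) n).[z] <= Cmod (rpoly (sqrt_tri R) n).[z].
Proof.
move=> z1; set T := rpoly (sqrt_tri R) n; set Ts := rpoly_rev (sqrt_tri R) n.
(* With z fixed, both sides are values at x = 1 of polynomials in x, so it suffices to treat the
   coefficients a_k = b_k x^k with x < 1. The dilated T_x(z) = T(x z) has no zero in the closed
   disk. *)
have -> : Ts.[z] = (\poly_(k < n.+1) (RtoC (sqrt_tri R k) * z ^+ (n - k))).[1].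
  by rewrite rpoly_revE horner_poly; apply: eq_bigr => k _; rewrite expr1n mulr1.
have -> : T.[z] = (\poly_(k < n.+1) (RtoC (sqrt_tri R k) * z ^+ k)).[1].
  by rewrite !horner_poly; apply: eq_bigr => k _; rewrite expr1n mulr1.
apply: poly_le_at1 => x /andP[x0 x1].
pose a k := sqrt_tri R k * x ^+ k.
have -> : (\poly_(k < n.+1) (RtoC (sqrt_tri R k) * z ^+ (n - k))).[RtoC x] = (rpoly_rev a n).[z].
  rewrite rpoly_revE horner_poly; apply: eq_bigr => k _.
  by rewrite rmorphM rmorphXn mulrAC.
have -> : (\poly_(k < n.+1) (RtoC (sqrt_tri R k) * z ^+ k)).[RtoC x] = (rpoly a n).[z].
  rewrite !horner_poly; apply: eq_bigr => k _.
  by rewrite rmorphM rmorphXn mulrAC.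
have [w Tw w2] := rpoly_tri_inverse n.
have wser : power_series_on 1 w (fun y => Cinv T.[y]).
  move=> y /RltP y1; have [_] := rpoly_tri_inverse_series Tw w2 y1.
  by apply: is_series_ext => k; rewrite CpowE.
have xy1 y : Cmod y <= 1 -> Cmod (RtoC x * y) < 1.
  move=> y1; rewrite CmodM CmodR gtr0_norm //; apply: le_lt_trans x1.
  by rewrite -[leRHS]mulr1 ler_wpM2l // ltW.
have invT y : Cmod y <= 1 -> (rpoly a n).[y] * Cinv (rpoly a n).[y] = 1.
  move=> /xy1 /(rpoly_tri_inverse_series Tw w2) [T0 _].
  by rewrite horner_rpoly_dilate; apply: Cinv_r.
have [K K0 TK] := poly_bound_ex (rpoly a n).
have [K' K'0 TsK] := poly_bound_ex (rpoly_rev a n).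
set A := (rpoly_rev a n).[z]; set B := (rpoly a n).[z].
have AB : Cmod (A * Cinv B) <= 1.
  apply: (@le_of_le_eps _ _ (K + K')) => [|e e0 _]; first exact: addr_ge0.
  have [L _ hL] : exists2 L, (0 <= L)%N & forall y, Cmod y <= 1 ->
      Cmod (Cinv T.[RtoC x * y] - (dilated_poly w x L).[y]) <= e.
    by apply: (dilated_poly_approx _ wser _ e0); rewrite x1 ltW.
  set q := dilated_poly w x L in hL.
  (* On the circle |T_x^* q| = |T_x q| = |1 - T_x (1/T_x - q)| with q close to 1/T_x; the maximum
     principle carries the bound 1 + e K inside. *)
  have circle t : Cmod (rpoly_rev a n * q).[cis t] <= 1 + e * K.
    have c1 : Cmod (cis t) <= 1 by rewrite Cmod_cis.
    rewrite hornerM CmodM Cmod_rpoly_rev -CmodM.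
    have -> : (rpoly a n).[cis t] * q.[cis t]
       = 1 + - ((rpoly a n).[cis t] * (Cinv (rpoly a n).[cis t] - q.[cis t])).
      by rewrite mulrBr invT //; ring.
    apply: le_trans (Cmod_ler_add _ _) _; rewrite CmodN CmodM Cmod_1 lerD2l mulrC.
    by rewrite ler_pM ?Cmod_ge0 ?TK // horner_rpoly_dilate hL.
  have := poly_max_principle circle z1; rewrite hornerM -/A => hAq.
  have -> : A * Cinv B = A * q.[z] + A * (Cinv B - q.[z]) by ring.
  apply: le_trans (Cmod_ler_add _ _) _; rewrite [e * _]mulrDr addrA lerD //.
  by rewrite CmodM mulrC ler_pM ?Cmod_ge0 ?TsK ?(ltW z1) // /B horner_rpoly_dilate hL ?ltW.
have -> : A = A * Cinv B * B by rewrite -mulrA [Cinv B * B]mulrC invT ?mulr1 // ltW.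
by rewrite CmodM -[leRHS]mul1r ler_wpM2r ?Cmod_ge0.
Qed.

Lemma taylor_polyE n z :
  taylor_poly (fps_RtoC (sqrt_tri R)) n z = (rpoly (sqrt_tri R) n).[z].
Proof. by rewrite /taylor_poly sum_nE horner_poly; apply: eq_bigr => k _; rewrite CpowE. Qed.

Lemma taylor_poly_reciprocalE n z :
  taylor_poly_reciprocal (fps_RtoC (sqrt_tri R)) n z = (rpoly_rev (sqrt_tri R) n).[z].
Proof.
by rewrite /taylor_poly_reciprocal sum_nE rpoly_revE; apply: eq_bigr => k _; rewrite CpowE.
Qed.

(** The coefficients are those of T^* w, with w the formal inverse of T; the last clause is the form
    in which they enter the coefficient identities. *)
Lemma extremal_schur n : exists a : fps C,
  [/\ schur_function (extremal (fps_RtoC (sqrt_tri R)) n) a,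
      forall z, Rlt (Cmod z) (IZR 1) -> taylor_poly (fps_RtoC (sqrt_tri R)) n z <> 0
    & a * fps_poly (rpoly (sqrt_tri R) n) = fps_poly (rpoly_rev (sqrt_tri R) n)].
Proof.
have [w Tw w2] := rpoly_tri_inverse n.
have T0 z : Rlt (Cmod z) (IZR 1) -> taylor_poly (fps_RtoC (sqrt_tri R)) n z <> 0.
  by move=> /RltP z1; rewrite taylor_polyE; case: (rpoly_tri_inverse_series Tw w2 z1).
have T0' z : Cmod z < 1 -> (rpoly (sqrt_tri R) n).[z] <> 0.
  by move=> z1; case: (rpoly_tri_inverse_series Tw w2 z1).
have extE z : extremal (fps_RtoC (sqrt_tri R)) n z
    = (rpoly_rev (sqrt_tri R) n).[z] * Cinv (rpoly (sqrt_tri R) n).[z].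
  by rewrite /extremal taylor_polyE taylor_poly_reciprocalE.
exists (fps_poly (rpoly_rev (sqrt_tri R) n) * w); split=> //; last first.
  by rewrite -mulrA [w * _]mulrC Tw mulr1.
split; [|split].
- move=> z z1; apply: ex_derive_C_mult; last apply: ex_derive_C_inv => //.
  + by apply: ex_derive_C_sum_n => k; apply: ex_derive_C_monomial.
  + by apply: T0.
  + by apply: ex_derive_C_sum_n => k; apply: ex_derive_C_monomial.
- move=> z /RltP z1; rewrite extE.
  have [_ /(@is_series_fps_polyM (rpoly_rev (sqrt_tri R) n))] := rpoly_tri_inverse_series Tw w2 z1.
  by apply: is_series_ext => k; rewrite CpowE.
apply: supnorm_le => z z1; rewrite extE CmodM.
have := rpoly_rev_le n z1; set p := Cmod _; set q := (_).[z] => pq.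
have q0 : 0 < Cmod q by apply/RltP/(proj1 (Cmod_gt_0 q)); exact: T0'.
have -> : Cmod (Cinv q) = (Cmod q)^-1 by rewrite Cmod_inv ?RealsE //; exact: T0'.
by rewrite ler_pdivrMr // mul1r.
Qed.

Lemma sum_extremal_coef (a : fps C) m :
  a * fps_poly (rpoly (sqrt_tri R) m.+2) = fps_poly (rpoly_rev (sqrt_tri R) m.+2) ->
  a m + a m.+1 + a m.+2 = RtoC (tri_sum m.+2).
Proof.
move=> aT; rewrite -(sum_coef_tri a (@coef_sqrt_tri_sqr m.+2)).
have -> : \sum_(i < m.+3) a i * (rpoly (sqrt_tri R) m.+2 * rpoly (sqrt_tri R) m.+2)`_(m.+2 - i)
   = (a * fps_poly (rpoly (sqrt_tri R) m.+2 * rpoly (sqrt_tri R) m.+2)) m.+2 by [].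
by rewrite fps_polyM mulrA aT -fps_polyM mulrC /fps_poly coef_rpolyM_rev.
Qed.

(** * The strict numerical bound and attainment *)

Lemma tri_sum_ge0 n : 0 <= tri_sum n.
Proof. by apply: sumr_ge0 => k _; exact: sqr_ge0. Qed.

(** The extremal function is now tested against U = 1 + z + z^2, whose means are bounded by
    [mean_tri]. *)
Lemma tri_sum_le m : tri_sum m.+2 <= tri_mean.
Proof.
have [a [[_ [fa /sup_one_bound f1]] _ /sum_extremal_coef aT]] := extremal_schur m.+2.
have <- : Cmod (RtoC (tri_sum m.+2)) = tri_sum m.+2.
  by rewrite CmodR ger0_norm ?tri_sum_ge0.
rewrite -aT -(@sum_coef_tri a (\poly_(k < 3) (1 : C)) m) => [|j _]; last first.
  by rewrite coef_poly; case: ifP.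
exact: schur_coef_bound fa f1 mean_tri.
Qed.

Lemma tri_sum_lt m : tri_sum m.+2 < tri_mean.
Proof.
(* The weak bound is taken at the larger order 3 (m + 2) + 1, where the last coefficient is positive
   by [sqrt_tri_mod1_gt0]. *)
apply: lt_le_trans (tri_sum_le (3 * m.+2 - 1)).
rewrite (_ : (3 * m.+2 - 1).+2 = (3 * m.+2 + 1))%N; last by lia.
rewrite /tri_sum -!(big_mkord xpredT (fun k => sqrt_tri R k ^+ 2)).
rewrite (@big_cat_nat _ _ _ m.+3 0 (3 * m.+2 + 1).+1) //=; last by lia.
rewrite ltrDl (@big_cat_nat _ _ _ (3 * m.+2 + 1)) //=; [|lia].
rewrite big_nat1 ltr_wpDl ?exprn_gt0 ?sqrt_tri_mod1_gt0 //.
by apply: sumr_ge0 => k _; exact: sqr_ge0.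
Qed.

Lemma supnorm_coeff_section (f : C -> C) (a : nat -> C) m :
    power_series_on 1 a f -> (forall z, Cmod z < 1 -> Cmod (f z) <= 1) ->
    a m + a m.+1 + a m.+2 = RtoC (tri_sum m.+2) ->
  supnorm (coeff_section a (m.+2 - 2) m.+2) = Rbar.Finite (tri_sum m.+2).
Proof.
move=> fa f1 asum; apply: is_lub_Rbar_unique; split.
  by move=> _ [z [/RltP z1 ->]]; apply/RleP; apply: coeff_section_le fa f1 z1.
have Cmod0_lt1 : Rlt (Cmod (RtoC 0)) (IZR 1) by rewrite Cmod_0; exact: Rlt_0_1.
(* The value at 0 excludes minus infinity as an upper bound. *)
case=> [M ub||ub] //; last by have := ub _ (ex_intro _ _ (conj Cmod0_lt1 erefl)).
apply/RleP; have <- : Cmod (RtoC (tri_sum m.+2)) = tri_sum m.+2.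
  by rewrite CmodR ger0_norm ?tri_sum_ge0.
(* A finite upper bound M dominates |P(x)| for 0 < x < 1, hence also |P(1)|, which is
   [tri_sum m.+2]. *)
pose P : {poly C} := (a m)%:P * 'X^m + (a m.+1)%:P * 'X^(m.+1) + (a m.+2)%:P * 'X^(m.+2).
have PE z : coeff_section a (m.+2 - 2) m.+2 z = P.[z].
  by rewrite coeff_sectionE !hornerE.
have PM x : 0 < x < 1 -> Cmod P.[RtoC x] <= M.
  move=> /andP[x0 x1]; apply/RleP; apply: ub; exists (RtoC x); rewrite PE; split=> //.
  by apply/RltP; rewrite CmodR gtr0_norm.
have M0 : 0 <= M.
  have h2 : 0 < (1 / 2 : R) < 1 by apply/andP; split; lra.
  exact: le_trans (Cmod_ge0 _) (PM _ h2).
have P1 : P.[1] = a m + a m.+1 + a m.+2 by rewrite -PE coeff_sectionE !expr1n !mulr1.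
have := @poly_le_at1 P (RtoC M)%:P; rewrite P1 asum hornerC [Cmod (RtoC M)]CmodR ger0_norm //.
by apply=> x x01; rewrite hornerC CmodR ger0_norm // PM.
Qed.

Lemma tri_main r g b m :
    Rlt (IZR 0) r -> sqrt_branch r g -> power_series_on r b g ->
  exists s : R,
    sum_n (fun k => Cpow (b k) 2) m.+2 = RtoC s /\
    (forall (f : C -> C) (a : nat -> C), schur_function f a ->
       Rbar_le (supnorm (coeff_section a (m.+2 - 2) m.+2)) (Rbar.Finite s)) /\
    Rlt s tri_mean /\
    (forall z : C, Rlt (Cmod z) (IZR 1) -> taylor_poly b m.+2 z <> RtoC (IZR 0)) /\
    (exists a : nat -> C, schur_function (extremal b m.+2) a /\
       supnorm (coeff_section a (m.+2 - 2) m.+2) = Rbar.Finite s).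
Proof.
move=> /RltP r0 gS gb; rewrite (sqrt_branch_coef r0 gS gb).
have [a [aS T0 /sum_extremal_coef aT]] := extremal_schur m.+2.
exists (tri_sum m.+2); split.
  rewrite sum_nE rmorph_sum; apply: eq_bigr => k _.
  by rewrite CpowE /fps_RtoC rmorphXn.
split; [|split; [|split]] => //.
- move=> f c [_ [fc /sup_one_bound f1]]; apply: supnorm_le => z z1.
  exact: coeff_section_le fc f1 z1.
- exact/RltP/tri_sum_lt.
exists a; split=> //; case: aS => _ [fa /sup_one_bound f1].
exact: supnorm_coeff_section fa f1 aT.
Qed.

End Landau.

Theorem theorem1p5 :
  forall (r : R) (g : C -> C) (b : nat -> C),
    (0 < r)%R -> sqrt_branch r g -> power_series_on r b g ->
  forall n : nat, (2 <= n)%nat ->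
  exists s : R,
    sum_n (fun k => b k ^ 2) n = RtoC s /\
    (forall (f : C -> C) (a : nat -> C), schur_function f a ->
       Rbar_le (supnorm (coeff_section a (n - 2) n)) s) /\
    (s < 1 / 3 + 2 * sqrt 3 / PI)%R /\
    (forall z : C, (Cmod z < 1)%R -> taylor_poly b n z <> 0) /\
    (exists a : nat -> C, schur_function (extremal b n) a /\
       supnorm (coeff_section a (n - 2) n) = Finite s).
Proof.
intros r g b r0 gS gb n n2; destruct n as [|[|m]]; [lia | lia |].
exact (Landau.tri_main m r0 gS gb).
Qed.
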